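(* Let $(X,d)$ be a compact perfect metric space and $N\in\mathbb N$. For each $n\in\mathbb N$ let $\{X;f_{n,1},\dots,f_{n,N}\}$ be an IFS with probability vector $(p_{n,1},\dots,p_{n,N})$, and let $\{X;f_1,\dots,f_N\}$ be an IFS with probability vector $(p_1,\dots,p_N)$. Suppose that each of these IFSs consists of contractive infinitesimal similitudes $g$ of $X$ for which $x\mapsto (Dg)(x)$ is strictly positive and Hölder continuous on $X$, and satisfies the bounded distortion hypothesis and the strong open set condition. Let $\mu_n$ and $\mu$ be the unique Borel probability measures on $X$ with $$\mu_n=\sum_{j=1}^N p_{n,j}\,\mu_n\circ f_{n,j}^{-1},\qquad \mu=\sum_{j=1}^N p_j\,\mu\circ f_j^{-1}.$$ Suppose that $f_{n,j}\to f_j$, $p_{n,j}\to p_j$, and $(Df_{n,j})\to(Df_j)$ as $n\to\infty$ for all $1\le j\le N$. Then, for $0<r<+\infty$, $D_r(\mu_n)\to D_r(\mu)$ as $n\to\infty$.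
   Context: Infinitesimal similitude: $f:X\to X$ is an infinitesimal similitude at $x\in X$ if for all sequences $(x_m),(y_m)$ in $X$ with $x_m\neq y_m$, $x_m\to x$, $y_m\to x$, the limit $(Df)(x):=\lim_{m\to\infty} \frac{d(f(x_m),f(y_m))}{d(x_m,y_m)}$ exists and is independent of the sequences; $f$ is an infinitesimal similitude on $X$ if this holds at every $x\in X$. Perfect means without isolated points. Contractive means Lipschitz with constant $<1$. Bounded distortion hypothesis for an IFS $\{X;f_1,\dots,f_N\}$: there is a constant $C_2$ (depending on the IFS) such that for every finite nonempty word $w=w_1\cdots w_k$ over $\{1,\dots,N\}$, with $f_w=f_{w_1}\circ\cdots\circ f_{w_k}$, and all $x\neq y$ in $X$, $\frac{(Df_w)(x)}{C_2}\le\frac{d(f_w(x),f_w(y))}{d(x,y)}\le C_2(Df_w)(x)$. Strong open set condition (SOSC) for an IFS $\{X;f_1,\dots,f_N\}$: there is a bounded nonempty open set $G\subset X$ with $\bigcup_i f_i(G)\subset G$, $f_i(G)\cap f_j(G)=\emptyset$ for $i\ne j$, and $E\cap G\ne\emptyset$, where $E$ is the unique nonempty compact set with $E=\bigcup_i f_i(E)$. Quantization dimension of order $r$: for a Borel probability measure $\nu$ on $X$, $V_{m,r}(\nu)=\inf\{\int d(x,A)^r\,d\nu(x): A\subset X,\ \mathrm{Card}(A)\le m\}$, where $d(x,A)$ is the distance from $x$ to $A$, and $D_r(\nu)=\lim_{m\to\infty}\frac{r\log m}{-\log V_{m,r}(\nu)}$ if the limit exists. *)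

(* Defs.v *)
From HB Require Import structures.
From mathcomp Require Import all_boot all_order all_algebra.
From mathcomp Require Import all_classical all_reals all_analysis.

Set Implicit Arguments.
Unset Strict Implicit.
Unset Printing Implicit Defensive.

Import Order.TTheory GRing.Theory Num.Theory.
Import numFieldNormedType.Exports.

Local Open Scope classical_set_scope.
Local Open Scope ring_scope.

(* Measurable types have to be pointed. *)
#[short(type="pointedMetricType")]
HB.structure Definition PointedMetric (R : numDomainType) :=
  {T of Pointed T & Metric R T}.

Section infinitesimal_similitude.
Context {R : realType} {X : metricType R}.
Implicit Types (f : X -> X) (x y : X).

Definition has_similitude_ratio f x (l : R) : Prop :=
  forall u v : nat -> X, (forall m, u m != v m) ->
    u @ \oo --> x -> v @ \oo --> x ->
    (fun m => mdist (f (u m)) (f (v m)) / mdist (u m) (v m)) @ \oo --> l.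

Definition infinitesimal_similitude f : Prop :=
  forall x, exists l, has_similitude_ratio f x l.

(* (Df)(x), with the junk value 0 if the limit does not exist; the limit is
   unique as soon as x is not isolated. *)
Definition similitude_ratio f x : R := xget 0 [set l | has_similitude_ratio f x l].

Definition contractive f : Prop :=
  exists2 c : R, 0 <= c < 1 & forall x y, mdist (f x) (f y) <= c * mdist x y.

Definition holder_continuous (h : X -> R) : Prop :=
  exists C a : R, 0 < a <= 1 /\ forall x y, `|h x - h y| <= C * mdist x y `^ a.

End infinitesimal_similitude.

Section ifs.
Context {R : realType} {X : metricType R} {N : nat}.
Implicit Types (f : 'I_N -> X -> X) (p : 'I_N -> R).

(* [:: w1; ...; wk] is sent to f_w1 \o ... \o f_wk. *)
Definition word_map f (w : seq 'I_N) : X -> X :=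
  foldr (fun j g => f j \o g) idfun w.

Definition similitude_ifs f : Prop :=
  forall j, [/\ contractive (f j), infinitesimal_similitude (f j),
    (forall x, 0 < similitude_ratio (f j) x)
    & holder_continuous (similitude_ratio (f j))].

Definition bounded_distortion f : Prop :=
  exists2 C : R, 0 < C & forall w : seq 'I_N, w != [::] ->
    forall x y, x != y ->
      similitude_ratio (word_map f w) x / C
        <= mdist (word_map f w x) (word_map f w y) / mdist x y
        <= C * similitude_ratio (word_map f w) x.

Definition attractor f (E : set X) : Prop :=
  [/\ E !=set0, compact E & E = \bigcup_j (f j @` E)].

Definition metric_bounded (G : set X) : Prop :=
  exists M : R, forall x y, G x -> G y -> mdist x y <= M.

Definition strong_open_set_condition f : Prop :=
  exists G E : set X,
    [/\ open G, metric_bounded G & G !=set0] /\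
    [/\ \bigcup_j (f j @` G) `<=` G,
      (forall i j, i != j -> (f i @` G) `&` (f j @` G) = set0),
      attractor f E & E `&` G !=set0].

Definition probability_vector p : Prop :=
  (forall j, 0 < p j) /\ \sum_j p j = 1.

End ifs.

Notation borel X := (g_sigma_algebraType (@open X)).

Section quantization.
Context {R : realType} {X : pointedMetricType R}.
Local Open Scope ereal_scope.

Definition invariant_measure (N : nat) (f : 'I_N -> X -> X) (p : 'I_N -> R)
    (mu : probability (borel X) R) : Prop :=
  forall A : set (borel X), measurable A ->
    mu A = \sum_(j < N) (p j)%:E * mu (f j @^-1` A).

(* edist_inf A x is the distance from x to A, see edist_inf_mdist; it is +oo
   when A is empty, so that the empty set does not contribute to the infimum. *)
Definition quantization_error (m : nat) (r : R) (nu : probability (borel X) R) :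
    \bar R :=
  ereal_inf [set \int[nu]_x (edist_inf A (x : X) `^ r) |
              A in [set A : set X | (A #<= `I_m)%card]].

(* With lne 0 = -oo and (+oo)^-1 = 0, the quotient is 0 when the error is 0. *)
Definition is_quantization_dimension (r : R) (nu : probability (borel X) R)
    (D : R) : Prop :=
  (fun m : nat => (r * ln m%:R)%:E / - lne (quantization_error m r nu)) @ \oo
    --> D%:E.

End quantization.

Lemma edist_mdist (R : realType) (X : metricType R) (x y : X) :
  edist (x, y) = (mdist x y)%:E.
Proof.
apply/eqP; rewrite eq_le; apply/andP; split.
  apply/lee_addgt0Pr => e e0; rewrite -EFinD; apply: edist_fin.
    by rewrite ltr_wpDl// mdist_ge0.
  by rewrite ballEmdist/= ltrDl.
apply: le_ereal_inf_tmp => _ [d [d0 +] <-] /=.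
by rewrite ballEmdist/= lee_fin => /ltW.
Qed.

Lemma edist_inf_mdist (R : realType) (X : metricType R) (A : set X) (x : X) :
  edist_inf A x = ereal_inf [set (mdist x a)%:E | a in A].
Proof.
rewrite /edist_inf; congr ereal_inf.
by apply: eq_imagel => a _; exact: edist_mdist.
Qed.

(* Main.v *)
(** Bounded distortion makes every [f_w] a similarity up to a factor not
    depending on [w], the ratio being the product [S_w] of the derivatives along
    the orbit of a base point.  With [q_w = p_w * S_w `^ r], let [th] be the
    infimum of the [t >= 0] for which the sums [\sum_(|w| = k) q_w `^ t] come
    arbitrarily close to [0]; then [0 <= th < 1] and the quantization dimension
    is [r * th / (1 - th)].

    Upper bound: if [t > th], replacing the system by its [k]-fold iterate makes
    [\sum_i q_i `^ t <= 1], and gluing images of sets adapted to the scales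
    [s * q_i] gives, for each scale [s], about [s `^ t] points with error of
    order [s `^ (t - 1)].

    Lower bound: by the strong open set condition some [f_u] maps [X] into the
    open set [G], so the maps [f_(w ++ u)], [|w| = k], have separated images.
    If [t < th] these still satisfy [\sum q `^ t >= 1], and they produce
    [s `^ t] pieces with pairwise disjoint neighbourhoods, each contributing at
    least [C / s] to the error of a set which misses its neighbourhood; [m]
    points meet at most [m] neighbourhoods.

    Continuity: since the derivatives converge uniformly and orbits stay
    uniformly close, the weights [q_w] of the approximating systems differ from
    those of the limit by at most [l ^+ |w|] with [l] close to [1], whatever
    their distortion constants; as [q_w <= g ^+ |w|] with [g < 1], this
    moves [th] by a small amount only. *)

Require Import Defs.
From mathcomp Require Import all_boot all_order all_algebra.
From mathcomp Require Import all_classical all_reals all_analysis.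
From mathcomp Require Import measurable_realfun ring lra.
Import Order.TTheory GRing.Theory Num.Theory.
Import numFieldNormedType.Exports.
Local Open Scope classical_set_scope.
Local Open Scope ring_scope.

(** * Invariant measures *)

Lemma lipschitz_continuous (R : realType) (X : metricType R) (g : X -> X)
    (c : R) : (forall x y, mdist (g x) (g y) <= c * mdist x y) -> continuous g.
Proof.
move=> gc x; apply/metricType_numDomainType.cvgrPdist_lt => e e0.
(* The constant [c] may be zero or negative, so the division uses [Num.max c 1]. *)
have c0 : 0 < Num.max c 1 by rewrite lt_max ltr01 orbT.
have : \forall y \near x, mdist x y < e / Num.max c 1.
  by apply: (@metricType_numDomainType.cvgr_dist_lt _ _ _ _ _ id) => //;
    rewrite divr_gt0.
apply: filterS => y; rewrite ltr_pdivlMr// mulrC; apply: le_lt_trans.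
by rewrite (le_trans (gc x y))// ler_wpM2r ?mdist_ge0// le_max lexx.
Qed.

Section borel.
Context {R : realType} {X : pointedMetricType R}.

Lemma continuous_borel_measurable (g : X -> X) :
  continuous g -> measurable_fun [set: borel X] (g : borel X -> borel X).
Proof.
move=> /continuousP cg.
apply: (@measurability _ _ (borel X) (borel X) _ _ (@open X)) => //.
move=> _ [B oB <-]; rewrite setTI; apply: sub_sigma_algebra; exact: cg.
Qed.

Lemma measurable_edist_inf (A : set X) (r : R) :
  measurable_fun [set: borel X]
    (fun x : borel X => (edist_inf A (x : X) `^ r)%E).
Proof.
apply: (measurableT_comp (measurable_poweR r)).
apply: (measurability _ (ErealGenOInfty.measurableE R)) => //.
move=> _ [_ [x ->] <-]; rewrite setTI; apply: sub_sigma_algebra.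
have /continuousP := @edist_inf_continuous R X A; apply.
rewrite (_ : [set` _] = [set y | x%:E < y]%E); first exact: open_ereal_gt_ereal.
by apply/seteqP; split => y /=; rewrite in_itv/= andbT.
Qed.

Lemma compact_borel_measurable (A : set X) :
  compact A -> measurable (A : set (borel X)).
Proof.
move=> /(compact_closed (@metric_hausdorff _ X)) /closed_openC oA.
by rewrite -(setCK A); apply: measurableC; apply: sub_sigma_algebra.
Qed.

Local Open Scope ereal_scope.

(** Invariance exhibits [mu] as a finite sum of scaled pushforwards, and the integral is linear in
    the measure. *)
Lemma invariant_integral (N : nat) (f : 'I_N -> X -> X) (p : 'I_N -> R)
    (mu : probability (borel X) R) (g : borel X -> \bar R) :
  (forall j, continuous (f j)) -> (forall j, 0 <= p j)%R ->
  invariant_measure f p mu ->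
  measurable_fun [set: borel X] g -> (forall x, 0 <= g x) ->
  \int[mu]_x g x = \sum_(j < N) (p j)%:E * \int[mu]_x g (f j x).
Proof.
move=> cf p0 inv mg g0.
have mf j := continuous_borel_measurable _ (cf j).
pose push j : {measure set (borel X) -> \bar R} :=
  measure_function_pushforward__canonical__measure_function_Measure mu (mf j).
(* [msum] takes measures indexed by natural numbers; the value [mzero] beyond [N] is never
   summed. *)
pose m_ (i : nat) : {measure set (borel X) -> \bar R} :=
  if insub i is Some j then mscale (NngNum (p0 j)) (push j)
  else mzero.
have -> : \int[mu]_x g x = \int[msum m_ N]_x g x.
  apply: eq_measure_integral => A mA _; apply: (etrans (inv A mA));
    rewrite /msum/=.
  apply: eq_bigr => j _; rewrite /m_.
  by case: insubP => [k _ /val_inj ->//|]; rewrite ltn_ord.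
rewrite ge0_integral_measure_sum//; apply: eq_bigr => j _.
rewrite /m_; case: insubP => [k _ /val_inj ->|]; last by rewrite ltn_ord.
by rewrite ge0_integral_mscale//= ge0_integral_pushforward.
Qed.

End borel.

(** * Sums over words and bounds over finite families *)

Lemma big_tuple0 (T : Type) (idx : T) (op : Monoid.com_law idx) (I : finType)
    (F : seq I -> T) : \big[op/idx]_(w : 0.-tuple I) F w = F [::].
Proof.
rewrite (big_pred1 [tuple]); first by [].
by move=> w; apply/esym/eqP; exact: tuple0.
Qed.

Lemma big_tupleS (T : Type) (idx : T) (op : Monoid.com_law idx) (I : finType)
    (k : nat) (F : seq I -> T) :
  \big[op/idx]_(w : k.+1.-tuple I) F w =
  \big[op/idx]_(i : I) \big[op/idx]_(v : k.-tuple I) F (i :: v).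
Proof.
rewrite pair_big/= (reindex (fun iv : I * k.-tuple I =>
  [tuple of iv.1 :: iv.2]))//=.
exists (fun w : k.+1.-tuple I => (thead w, [tuple of behead w])).
  by move=> [i v] _; congr pair; apply: val_inj.
by move=> w _; rewrite [w in RHS]tuple_eta; apply: val_inj.
Qed.

Lemma finite_lower_bound (R : realType) (I : finType) (q : I -> R) :
  (forall i, 0 < q i) -> exists2 a : R, 0 < a <= 1 & forall i, a <= q i.
Proof.
move=> q0; exists (\big[Order.min/1]_i q i) => [|i].
  apply/andP; split; last exact: bigmin_le_id.
  by apply/bigmin_gtP; split => // i _; exact: q0.
exact: bigmin_le_cond.
Qed.

Lemma finite_upper_bound (R : realType) (I : finType) (q : I -> R) :
  (forall i, q i < 1) -> exists2 a : R, 0 < a < 1 & forall i, q i <= a.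
Proof.
move=> q1; have [|a a01 aq] := @finite_lower_bound R I (fun i => 1 - q i).
  by move=> i; rewrite subr_gt0.
(* As [a] may equal 1, the bound [1 - a] could vanish; halving [a] keeps it positive. *)
exists (1 - a / 2) => [|i]; first lra.
by have := aq i; lra.
Qed.

Lemma card_le_fin (J : finType) (m : nat) :
  ([set: J] #<= `I_m)%card = (#|J| <= m)%N.
Proof.
rewrite -card_le_II; apply: card_le_eql.
rewrite card_eq_sym (card_eql card_II) card_eq_sym.
pose e (i : 'I_#|J|) : J := enum_val i.
have <- : range e = [set: J].
  apply/seteqP; split => // j _; exists (enum_rank j) => //.
  exact: enum_rankK.
by apply: inj_card_eq => i j _ _; exact: enum_val_inj.
Qed.

Section words.
Context {R : realType} {X : pointedMetricType R} {N : nat}.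
Implicit Types (f : 'I_N -> X -> X) (p : 'I_N -> R).

Definition word_weight p (w : seq 'I_N) : R := \prod_(j <- w) p j.

Lemma word_weight_gt0 p w : (forall j, 0 < p j) -> 0 < word_weight p w.
Proof. by move=> p0; rewrite /word_weight prodr_gt0. Qed.

Lemma word_map_cat f w v : word_map f (w ++ v) = word_map f w \o word_map f v.
Proof. by elim: w => //= j w ->. Qed.

Lemma word_map_continuous f w :
  (forall j, continuous (f j)) -> continuous (word_map f w).
Proof.
move=> cf; elim: w => [|j w ih] x; first by move=> B.
by apply: (@continuous_comp _ _ _ (word_map f w) (f j)); [exact: ih|exact: cf].
Qed.

Local Open Scope ereal_scope.

Lemma invariant_integral_word f p (mu : probability (borel X) R) (k : nat)
    (g : borel X -> \bar R) :
  (forall j, continuous (f j)) -> (forall j, 0 < p j)%R ->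
  invariant_measure f p mu ->
  measurable_fun [set: borel X] g -> (forall x, 0 <= g x) ->
  \int[mu]_x g x = \sum_(w : k.-tuple 'I_N)
    (word_weight p w)%:E * \int[mu]_x g (word_map f w x).
Proof.
move=> cf p0 inv; have p0' j : (0 <= p j)%R by exact: ltW.
elim: k g => [|k ih] g mg g0.
  by rewrite (big_tuple0 _ _ _ _ (fun w => (word_weight p w)%:E *
    \int[mu]_x g (word_map f w x)))/= /word_weight big_nil mul1e.
rewrite (big_tupleS _ _ _ _ _ (fun w => (word_weight p w)%:E *
    \int[mu]_x g (word_map f w x))).
rewrite (invariant_integral _ _ _ _ _ cf p0' inv mg g0).
apply: eq_bigr => j _; rewrite ih//; last first.
  exact: (measurableT_comp mg (continuous_borel_measurable _ (cf j))).
rewrite ge0_sume_distrr => [|v _]; last first.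
  by apply: mule_ge0; [rewrite lee_fin ltW ?word_weight_gt0|exact: integral_ge0].
by apply: eq_bigr => v _; rewrite muleA -EFinM /word_weight big_cons.
Qed.

(** One term of the invariance identity is kept at each letter. The lower bound works with the words
    [w ++ u], which do not exhaust a level, so an inequality for a single word is the right form. *)
Lemma invariant_measure_word f p (mu : probability (borel X) R) w
    (A : set (borel X)) :
  (forall j, continuous (f j)) -> (forall j, 0 < p j)%R ->
  invariant_measure f p mu -> measurable A ->
  (word_weight p w)%:E * mu (word_map f w @^-1` A) <= mu A.
Proof.
move=> cf p0 inv; elim: w A => [|j w ih] A mA.
  by rewrite /word_weight big_nil mul1e.
have mfA : measurable (f j @^-1` A : set (borel X)).
  by rewrite -(setTI (_ @^-1` _)); apply: continuous_borel_measurable.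
rewrite [leRHS](inv A mA) (bigD1 j)//=.
apply: (@le_trans _ _ ((p j)%:E * mu (f j @^-1` A))); last first.
  by rewrite leeDl// sume_ge0// => i _; rewrite mule_ge0// lee_fin ltW.
rewrite /word_weight big_cons EFinM -muleA lee_pmul2l//.
  exact: ih.
by rewrite lte_fin.
Qed.

End words.

(** * Upper bound for a finite system *)

Section quantization_upper.
Context {R : realType} {X : pointedMetricType R} {I : finType}.
Variables (F : I -> X -> X) (P c : I -> R) (mu : probability (borel X) R).
Variables (r t M : R).
Hypotheses (r0 : 0 < r) (t01 : 0 < t < 1) (P0 : forall i, 0 < P i).
Hypotheses (c0 : forall i, 0 < c i) (M0 : 0 < M).
Hypothesis XM : forall x y : X, mdist x y <= M.
Hypothesis Fc : forall i x y, mdist (F i x) (F i y) <= c i * mdist x y.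
Hypothesis muF : forall g : borel X -> \bar R,
  measurable_fun [set: borel X] g -> (forall x, (0 <= g x)%E) ->
  (\int[mu]_x g x = \sum_i (P i)%:E * \int[mu]_x g (F i x))%E.
Let q i := P i * c i `^ r.
Hypothesis q1 : forall i, q i < 1.
Hypothesis qt : \sum_i q i `^ t <= 1.

Lemma edist_inf_image_le (c' : R) (g : X -> X) (A B : set X) x : 0 < c' ->
  (forall y, mdist (g x) (g y) <= c' * mdist x y) -> g @` A `<=` B ->
  (edist_inf B (g x) <= c'%:E * edist_inf A x)%E.
Proof.
move=> c'0 gc AB; rewrite -lee_pdivrMl// !edist_inf_mdist.
apply: le_ereal_inf_tmp => _ [a Aa <-].
rewrite lee_pdivrMl// -EFinM.
apply: (@le_trans _ _ (mdist (g x) (g a))%:E); last by rewrite lee_fin.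
by apply: ereal_inf_lbound; exists (g a) => //; apply: AB; exists a.
Qed.

(* By induction on [n], for [s <= b ^- n]: a scale [s > 1] is reached by applying
   the maps [F i] to the sets found for the smaller scales [s * q i]. *)
Lemma quantization_upper : exists C D : R, [/\ 0 < C, 0 < D &
  forall s, 1 <= s -> exists (J : finType) (g : J -> X),
    #|J|%:R <= C * s `^ t /\
    (\int[mu]_x (edist_inf (range g) (x : X) `^ r) <= (D * s `^ (t - 1))%:E)%E].
Proof.
have q0 i : 0 < q i by rewrite mulr_gt0// powR_gt0.
have [a /andP[a0 a1] aq] := @finite_lower_bound R I q q0.
have [b /andP[b0 b1] qb] := @finite_upper_bound R I q q1.
have [t0 t1] := andP t01.
(* These constants fit a single point at scales [a <= s <= 1]: there [a]^ (- t) * s [^ t >= 1], and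
   [s]^ (t - 1) >= 1[leaves room for the trivial error]M [^ r]. *)
exists (a `^ (- t)), (M `^ r); split; [by rewrite powR_gt0..|].
suff H : forall n (s : R), a <= s -> s * b ^+ n <= 1 ->
  exists (J : finType) (g : J -> X),
    #|J|%:R <= a `^ (- t) * s `^ t /\
    (\int[mu]_x (edist_inf (range g) (x : X) `^ r) <=
       (M `^ r * s `^ (t - 1))%:E)%E.
  move=> s s1; have s0 : 0 < s by lra.
  have : (fun n => b ^+ n) @ \oo --> (0 : R).
    by apply: cvg_expr; rewrite ger0_norm ?ltW.
  move=> /cvgr0Pnorm_lt /(_ s^-1); rewrite invr_gt0 =>
    /(_ s0)[n _ /(_ n (leqnn _))].
  rewrite ger0_norm ?exprn_ge0 1?ltW// => bn.
  apply: (H n s); first lra.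
  by rewrite -(mulfV (lt0r_neq0 s0)) ler_pM2l// ltW.
have base : forall s : R, a <= s -> s <= 1 -> exists (J : finType) (g : J -> X),
    #|J|%:R <= a `^ (- t) * s `^ t /\
    (\int[mu]_x (edist_inf (range g) (x : X) `^ r) <=
       (M `^ r * s `^ (t - 1))%:E)%E.
  move=> s as_ s1; have s0 : 0 < s by lra.
  exists unit, (fun=> point); split.
    rewrite card_unit powRN mulrC ler_pdivlMr ?powR_gt0// mul1r.
    by rewrite ge0_ler_powR ?nnegrE//; lra.
  apply: (@le_trans _ _ (\int[mu]_x cst (M `^ r)%:E x)%E); last first.
    rewrite integral_cst//
      [X in (_ * X)%E](probability_setT mu) mule1 lee_fin ler_peMr ?powR_ge0//.
    have := @ger_powR R s; rewrite s0 s1 => /(_ isT (t - 1) 0); rewrite powRr0.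
    by apply; lra.
  apply: ge0_le_integral => //.
  - by move=> x _; exact: poweR_ge0.
  - exact: measurable_edist_inf.
  - move=> x _; rewrite /cst -poweR_EFin; apply: gt0_ler_poweR.
    + exact: ltW.
    + by rewrite in_itv/= edist_inf_ge0 leey.
    + by rewrite in_itv/= leey lee_fin ltW.
    rewrite edist_inf_mdist; apply: (@le_trans _ _ (mdist x point)%:E).
      by apply: ereal_inf_lbound; exists point => //; exists tt.
    by rewrite lee_fin.
elim=> [|n ih] s as_ sn; first by apply: base => //; rewrite expr0 mulr1 in sn.
have [|s1] := leP s 1; first exact: base.
have s0 : 0 < s by lra.
have [J [g gP]] : exists (J : I -> finType) (g : forall i, J i -> X), forall i,
    #|J i|%:R <= a `^ (- t) * (s * q i) `^ t /\
    (\int[mu]_x (edist_inf (range (g i)) (x : X) `^ r) <=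
       (M `^ r * (s * q i) `^ (t - 1))%:E)%E.
  have as_q i : a <= s * q i by rewrite (le_trans (aq i))// ler_peMl ?ltW.
  have sqb i : s * q i * b ^+ n <= 1.
    rewrite -mulrA (le_trans _ sn)// ler_pM2l// exprS ler_pM2r ?exprn_gt0//.
  pose Hi i := ih (s * q i) (as_q i) (sqb i).
  exists (fun i => projT1 (cid (Hi i))).
  exists (fun i => projT1 (cid (projT2 (cid (Hi i))))) => i.
  exact: projT2 (cid (projT2 (cid (Hi i)))).
have splitq u i : (s * q i) `^ u = s `^ u * q i `^ u.
  by rewrite powRM ?ltW.
exists {i : I & J i}, (fun ij => F (tag ij) (g (tag ij) (tagged ij))); split.
  rewrite card_tagged sumnE big_map big_enum/= natr_sum.
  apply: (@le_trans _ _ (\sum_i a `^ (- t) * s `^ t * q i `^ t)).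
    by apply: ler_sum => i _; rewrite -mulrA -splitq; exact: (gP i).1.
  by rewrite -mulr_sumr ler_piMr// mulr_ge0 ?powR_ge0.
rewrite muF; last 2 first.
- exact: measurable_edist_inf.
- by move=> x; exact: poweR_ge0.
apply: (@le_trans _ _ (\sum_i (M `^ r * s `^ (t - 1) * q i `^ t)%:E)%E);
  last first.
  by rewrite sumEFin lee_fin -mulr_sumr ler_piMr// mulr_ge0 ?powR_ge0.
apply: lee_sum => i _.
apply: (@le_trans _ _ ((P i)%:E * \int[mu]_x ((c i `^ r)%:E *
    edist_inf (range (g i)) (x : X) `^ r))%E).
  rewrite lee_pmul2l ?lte_fin//; apply: ge0_le_integral => //.
  - by move=> x _; exact: poweR_ge0.
  - apply: (measurableT_comp (measurable_edist_inf _ _)).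
    exact: continuous_borel_measurable _ (lipschitz_continuous _ _ _ _ (Fc i)).
  - apply: measurable_funeM; exact: measurable_edist_inf.
  - have ci0 : (0 <= (c i)%:E)%E by rewrite lee_fin ltW.
    move=> x _; rewrite -poweR_EFin -poweRM ?edist_inf_ge0//.
    apply: gt0_ler_poweR.
    + exact: ltW.
    + by rewrite in_itv/= edist_inf_ge0 leey.
    + by rewrite in_itv/= leey andbT mule_ge0// ?edist_inf_ge0.
    apply: edist_inf_image_le => // _ [_ [j _ <-] <-].
    by exists (Tagged J j).
rewrite ge0_integralZl//; last 3 first.
- exact: measurable_edist_inf.
- by move=> x _; exact: poweR_ge0.
- by rewrite lee_fin powR_ge0.
rewrite muleA -EFinM.
apply: (@le_trans _ _ ((q i)%:E * (M `^ r * (s * q i) `^ (t - 1))%:E)%E).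
  rewrite lee_pmul2l; [exact: (gP i).2|by []|by rewrite lte_fin; exact: q0].
rewrite -EFinM lee_fin splitq -(mulr_powRB1 (ltW (q0 i)) t0).
by rewrite le_eqVlt; apply/orP; left; apply/eqP; ring.
Qed.
End quantization_upper.

(** * Lower bound for a finite system *)

Section separated_family.
Context {R : realType} {X : pointedMetricType R}.
Variables (mu : probability (borel X) R) (r : R).

(** Bounding distances below by sums of radii, instead of asking for disjoint balls, passes easily
    to images under maps that are bounded below. Compact pieces are Borel and stay so under
    continuous maps. [eta] is what a piece contributes to the error of a set avoiding its
    neighbourhood. *)
Definition separated_family (J : finType) (U : J -> set X) (rho : J -> R)
    (eta : R) : Prop :=
  (forall j, [/\ compact (U j), 0 < rho j &
    (eta%:E <= mu (U j) * (rho j `^ r)%:E)%E]) /\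
  forall i j x y, i != j -> U i x -> U j y -> rho i + rho j <= mdist x y.

(** By the triangle inequality a point of [A] is close to at most one piece, so at least [#|J| - m]
    pieces are missed. On a missed piece [U j] the distance to [A] is at least [rho j]. *)
Lemma separated_family_error (J : finType) (U : J -> set X) (rho : J -> R)
    (eta : R) (m : nat) (A : set X) : 0 < r -> 0 <= eta ->
  separated_family J U rho eta -> (A #<= `I_m)%card ->
  (((#|J|%:R - m%:R) * eta)%:E <= \int[mu]_x (edist_inf A (x : X) `^ r))%E.
Proof.
move=> r0 eta0 [UJ Usep] Am.
pose nearA j a := A a /\ exists2 x, U j x & mdist x a < rho j.
pose B := [set j | asbool (exists a, nearA j a)]%SET.
have [a aP] : exists a : J -> X, forall j, j \in B -> nearA j (a j).
  exists (fun j => xget point [set a | nearA j a]) => j; rewrite inE.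
  by move=> /asboolP[a ja]; exact: (xgetPex _ (ex_intro _ a ja)).
have Bm : (#|B| <= m)%N.
  rewrite -card_le_II; apply: card_le_trans Am.
  pose g (i : 'I_#|B|) := a (enum_val i).
  apply: (@card_le_trans _ _ _ (range g)).
    have -> : (`I_#|B| #<= range g)%card = (`I_#|B| #<= [set: 'I_#|B|])%card.
      apply: card_le_eqr; apply: inj_card_eq => i j _ _ gij.
      apply: enum_val_inj; apply/eqP/negPn/negP => ij.
      have [_ [x Ux xa]] := aP _ (enum_valP i).
      have [_ [y Uy ya]] := aP _ (enum_valP j).
      have := Usep _ _ _ _ ij Ux Uy; apply/negP; rewrite -ltNge.
      rewrite (le_lt_trans (metric_triangle x (g i) y))// ltrD//.
      by rewrite gij metric_sym.
    by rewrite (card_le_eql card_II) card_lexx.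
  by apply: subset_card_le => _ [i _ <-]; exact: (aP _ (enum_valP i)).1.
have mU j : measurable (U j : set (borel X)).
  by apply: compact_borel_measurable; have [] := UJ j.
have mE := measurable_edist_inf A r.
(* The integral is restricted to the union of the missed pieces, which are disjoint. *)
pose D : set (borel X) := \big[setU/set0]_(j <- enum (~: B)%SET) U j.
have mD : measurable D by exact: bigsetU_measurable.
apply: (@le_trans _ _ (\int[mu]_(x in D) (edist_inf A (x : X) `^ r))%E);
  last first.
  by apply: ge0_subset_integral => // x _; exact: poweR_ge0.
rewrite ge0_integral_bigsetU//; last 4 first.
- exact: enum_uniq.
- apply/trivIsetP => i j _ _ ij; apply/seteqP; split => // x [Ux Uy].
  have := Usep _ _ _ _ ij Ux Uy; rewrite mdistxx; apply/negP.
  by rewrite -ltNge addr_gt0//; [have [] := UJ i|have [] := UJ j].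
- exact: measurable_funTS.
- by move=> x _; exact: poweR_ge0.
apply: (@le_trans _ _ (\sum_(j <- enum (~: B)%SET) eta%:E)%E).
  rewrite sumEFin lee_fin big_enum/= sumr_const -[leRHS]mulr_natl ler_wpM2r//.
  rewrite lerBlDr -natrD ler_nat -(cardsC B) addnC leq_add2l//.
rewrite big_seq [leRHS]big_seq; apply: lee_sum => j.
rewrite mem_enum inE => jB.
have [_ rho0 /le_trans] := UJ j; apply.
rewrite muleC -integral_cst//; apply: ge0_le_integral => //.
- by move=> x _; rewrite lee_fin powR_ge0.
- exact: measurable_funTS.
move=> x Ux; rewrite /cst -poweR_EFin; apply: gt0_ler_poweR.
- exact: ltW.
- by rewrite in_itv/= leey lee_fin ltW.
- by rewrite in_itv/= leey edist_inf_ge0.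
rewrite edist_inf_mdist; apply: le_ereal_inf_tmp => _ [b Ab <-].
rewrite lee_fin leNgt; apply: contra jB => xb.
by rewrite inE; apply/asboolP; exists b; split => //; exists x.
Qed.

End separated_family.

Section quantization_lower.
Context {R : realType} {X : pointedMetricType R} {I : finType}.
Variables (F : I -> X -> X) (P b : I -> R) (mu : probability (borel X) R).
Variables (r t d : R).
Hypotheses (compactX : compact [set: X]).
Hypotheses (t0 : 0 < t) (P0 : forall i, 0 < P i) (d0 : 0 < d).
Hypotheses (b01 : forall i, 0 < b i <= 1).
Hypothesis cF : forall i, continuous (F i).
Hypothesis Fb : forall i x y, b i * mdist x y <= mdist (F i x) (F i y).
Hypothesis Fd : forall i j x y, i != j -> d <= mdist (F i x) (F j y).
Hypothesis muF : forall i (A : set (borel X)), measurable A ->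
  ((P i)%:E * mu (F i @^-1` A) <= mu A)%E.
Let q i := P i * b i `^ r.
Hypothesis q1 : forall i, q i < 1.
Hypothesis qt : 1 <= \sum_i q i `^ t.

(** The same recursion on scales as in [quantization_upper], now transporting separated families:
    the images under one map stay separated by [Fb], those under different maps by [Fd]. *)
Lemma quantization_lower : exists2 C : R, 0 < C &
  forall s, 1 <= s -> exists (J : finType) (U : J -> set X) (rho : J -> R),
    s `^ t <= #|J|%:R /\ separated_family mu r J U rho (C / s).
Proof.
have b0 i : 0 < b i by case/andP: (b01 i).
have q0 i : 0 < q i by rewrite mulr_gt0// powR_gt0.
have [a /andP[a0 a1] aq] := @finite_lower_bound R I q q0.
have [e /andP[e0 e1] qe] := @finite_upper_bound R I q q1.
(* Two radii bounded by [d / 2] sum to at most [d], the gap between images of different maps. The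
   recursive claim therefore also records [rho j <= rho0]. *)
pose rho0 := d / 2; have rho00 : 0 < rho0 by rewrite divr_gt0.
exists (rho0 `^ r * a); first by rewrite mulr_gt0// powR_gt0.
suff H : forall n (s : R), a <= s -> s * e ^+ n <= 1 ->
    exists (J : finType) (U : J -> set X) (rho : J -> R),
    [/\ s `^ t <= #|J|%:R, forall j, rho j <= rho0 &
      separated_family mu r J U rho (rho0 `^ r * a / s)].
  move=> s s1; have s0 : 0 < s by lra.
  have : (fun n => e ^+ n) @ \oo --> (0 : R).
    by apply: cvg_expr; rewrite ger0_norm ?ltW.
  move=> /cvgr0Pnorm_lt /(_ s^-1); rewrite invr_gt0 =>
    /(_ s0)[n _ /(_ n (leqnn _))].
  rewrite ger0_norm ?exprn_ge0 1?ltW// => bn.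
  have [||J [U [rho [sJ _ H']]]] := H n s; first lra.
    by rewrite -(mulfV (lt0r_neq0 s0)) ler_pM2l// ltW.
  by exists J, U, rho.
have base : forall s : R, a <= s -> s <= 1 ->
    exists (J : finType) (U : J -> set X) (rho : J -> R),
    [/\ s `^ t <= #|J|%:R, forall j, rho j <= rho0 &
      separated_family mu r J U rho (rho0 `^ r * a / s)].
  move=> s as_ s1; have s0 : 0 < s by lra.
  (* For [a <= s <= 1] the whole space is the only piece; its mass is 1 and [a / s <= 1]. *)
  exists unit, (fun=> setT), (fun=> rho0); split => //.
    have := @ge0_ler_powR R t (ltW t0) s 1; rewrite powR1 card_unit.
    by apply; rewrite ?nnegrE// ltW.
  split; last by move=> [] [].
  move=> _; split => //.
  rewrite [X in (X * _)%E](probability_setT mu) mul1e lee_fin -mulrA.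
  by rewrite ler_piMr ?powR_ge0// ler_pdivrMr// mul1r.
elim=> [|n ih] s as_ sn; first by apply: base => //; rewrite expr0 mulr1 in sn.
have [|s1] := leP s 1; first exact: base.
have s0 : 0 < s by lra.
have [J [U [rho UP]]] : exists (J : I -> finType) (U : forall i, J i -> set X)
    (rho : forall i, J i -> R), forall i,
    [/\ (s * q i) `^ t <= #|J i|%:R, forall j, rho i j <= rho0 &
      separated_family mu r (J i) (U i) (rho i) (rho0 `^ r * a / (s * q i))].
  have as_q i : a <= s * q i by rewrite (le_trans (aq i))// ler_peMl ?ltW.
  have sqb i : s * q i * e ^+ n <= 1.
    rewrite -mulrA (le_trans _ sn)// ler_pM2l// exprS ler_pM2r ?exprn_gt0//.
  pose Hi i := ih (s * q i) (as_q i) (sqb i).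
  exists (fun i => projT1 (cid (Hi i))).
  exists (fun i => projT1 (cid (projT2 (cid (Hi i))))).
  exists (fun i => projT1 (cid (projT2 (cid (projT2 (cid (Hi i))))))) => i.
  exact: projT2 (cid (projT2 (cid (projT2 (cid (Hi i)))))).
have splitq u i : (s * q i) `^ u = s `^ u * q i `^ u.
  by rewrite powRM ?ltW.
have rhoP i j : 0 < rho i j <= rho0.
  by have [_ -> [/(_ j)[_ -> _] _]] := UP i.
have brho i j : b i * rho i j <= rho0.
  have [/andP[_ b1] /andP[r1 r2]] := (b01 i, rhoP i j).
  by rewrite (le_trans _ r2)// ler_piMl// ltW.
exists {i : I & J i}, (fun ij => F (tag ij) @` U (tag ij) (tagged ij)),
  (fun ij => b (tag ij) * rho (tag ij) (tagged ij)); split => //.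
  rewrite card_tagged sumnE big_map big_enum/= natr_sum.
  apply: (@le_trans _ _ (\sum_i s `^ t * q i `^ t)).
    by rewrite -mulr_sumr ler_peMr// powR_ge0.
  by apply: ler_sum => i _; rewrite -splitq; have [] := UP i.
split=> [[i j]/=|].
  have [_ _ [/(_ j)[cU rho_gt0 Ueta] _]] := UP i.
  split; [|by rewrite mulr_gt0|].
    by apply: continuous_compact => //; exact/continuous_subspaceT.
  have cFU : compact (F i @` U i j).
    by apply: continuous_compact => //; exact/continuous_subspaceT.
  have mFU := compact_borel_measurable _ cFU.
  have mU := compact_borel_measurable _ cU.
  have mFFU : measurable (F i @^-1` (F i @` U i j) : set (borel X)).
    by rewrite -(setTI (_ @^-1` _)); apply: continuous_borel_measurable.
  (* The mass of the image is at least [P i * mu (U i j)] and its radius is [b i * rho i j], so the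
     contribution is multiplied by [q i], matching the passage from [s * q i] to [s]. *)
  apply: (@le_trans _ _ ((P i)%:E * mu (U i j) * ((b i * rho i j) `^ r)%:E)%E);
    last first.
    rewrite lee_wpmul2r ?lee_fin ?powR_ge0//; apply: le_trans (muF i _ mFU).
    rewrite lee_pmul2l ?lte_fin//; apply: le_measure; rewrite ?inE//.
    exact: preimage_image.
  have -> : ((b i * rho i j) `^ r)%:E = ((b i `^ r)%:E * (rho i j `^ r)%:E)%E.
    by rewrite -EFinM powRM ?ltW.
  rewrite muleACA -EFinM -/(q i).
  rewrite -lee_pdivrMl// -EFinM (le_trans _ Ueta)// lee_fin.
  by rewrite le_eqVlt; apply/orP; left; apply/eqP; field; rewrite ?lt0r_neq0.
move=> [i j] [i' j'] _ _ /= ij [x Ux <-] [y Uy <-].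
have [ii'|ii'] := eqVneq i i'.
  subst i'; have jj' : j != j' by apply: contra ij => /eqP ->.
  have [_ _ [_ Usep]] := UP i.
  by rewrite -mulrDr (le_trans _ (Fb i x y))// ler_pM2l//; exact: Usep.
apply: le_trans (Fd _ _ x y ii').
by have := brho i j; have := brho i' j'; rewrite /rho0; lra.
Qed.

End quantization_lower.

(** * The critical exponent *)

Lemma ler_powRl (R : realType) (u x y : R) :
  0 <= u -> 0 <= x -> x <= y -> x `^ u <= y `^ u.
Proof.
by move=> u0 x0 xy; rewrite ge0_ler_powR// nnegrE// (le_trans x0).
Qed.

Lemma powR_exprn (R : realType) (x u : R) (k : nat) : 0 <= x ->
  (x `^ u) ^+ k = (x ^+ k) `^ u.
Proof.
move=> x0; rewrite -powR_mulrn ?powR_ge0// -powRrM mulrC powRrM.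
by rewrite powR_mulrn.
Qed.

Section critical_exponent.
Context {R : realType} {N : nat}.
Implicit Types (q : seq 'I_N -> R) (t : R).

Definition level_sum q (k : nat) t : R := \sum_(w : k.-tuple 'I_N) q w `^ t.

(** Asking for arbitrarily small sums, and not merely for one below 1, lets constant factors such as
    powers of the distortion constant be absorbed. *)
Definition subcritical q t : Prop :=
  forall e, 0 < e -> exists2 k, (0 < k)%N & level_sum q k t < e.

(** The analogue of the zero of a topological pressure. The infimum of the empty set is 0, so the
    lemma on exponents above it also asks for some subcritical exponent. *)
Definition critical_exponent q : R := inf [set t | 0 <= t /\ subcritical q t].

Lemma level_sum_ge0 q k t : 0 <= level_sum q k t.
Proof. by apply: sumr_ge0 => w _; exact: powR_ge0. Qed.

Lemma level_sum_shift q k t d (l g : R) (q' : seq 'I_N -> R) :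
  (forall w, 0 < q w <= g ^+ size w) -> (forall w, 0 < q' w <=
    l ^+ size w * q w) ->
  0 < l -> 0 < g -> 0 <= d -> 0 <= t + d ->
  level_sum q' k (t + d) <= (l `^ (t + d) * g `^ d) ^+ k * level_sum q k t.
Proof.
move=> qg ql l0 g0 d0 td0; rewrite /level_sum mulr_sumr; apply: ler_sum => w _.
have /andP[q0 qgw] := qg w; have /andP[q'0 qlw] := ql w.
rewrite size_tuple in qgw qlw.
have lk : 0 <= l ^+ k by rewrite exprn_ge0 ?ltW.
have gk : 0 <= g ^+ k by rewrite exprn_ge0 ?ltW.
apply: (@le_trans _ _ ((l ^+ k * q w) `^ (t + d))).
  by rewrite ge0_ler_powR// nnegrE ?mulr_ge0// ltW.
rewrite powRM ?(ltW q0)// exprMn !powR_exprn ?(ltW l0) ?(ltW g0)//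
  -mulrA ler_wpM2l ?powR_ge0//.
rewrite powRD; last by rewrite (gt_eqF q0) implybT.
rewrite mulrC ler_wpM2r ?powR_ge0// ge0_ler_powR// nnegrE ?(ltW q0)//.
Qed.

Section one_weight.
Variables (q : seq 'I_N -> R) (g : R).
Hypotheses (g01 : 0 < g < 1) (qg : forall w, 0 < q w <= g ^+ size w).

Let level_sum_decay k t d : 0 <= d -> 0 <= t ->
  level_sum q k (t + d) <= (g `^ d) ^+ k * level_sum q k t.
Proof.
move=> d0 t0; have /andP[g0 _] := g01.
have := @level_sum_shift q k t d 1 g q qg.
rewrite powR1 mul1r; apply => // [w|]; last by rewrite addr_ge0.
by rewrite expr1n mul1r lexx; have /andP[->] := qg w.
Qed.

Lemma subcritical_le t u : 0 <= t -> t <= u -> subcritical q t ->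
  subcritical q u.
Proof.
move=> t0 tu sub e e0; have [k k0 ke] := sub e e0; exists k => //.
have /andP[g0 g1] := g01.
apply: le_lt_trans ke; rewrite -(subrKC t u).
apply: le_trans (level_sum_decay _ _ _ _ t0) _; first by rewrite subr_ge0.
rewrite ler_piMl ?level_sum_ge0// exprn_ile1 ?powR_ge0//.
by rewrite -(powRr0 g) ger_powR ?g0 ?(ltW g1)// subr_ge0.
Qed.

Lemma critical_exponent_ge0 : 0 <= critical_exponent q.
Proof.
rewrite /critical_exponent; set E := [set t | _].
have [->|/set0P E0] := eqVneq E set0; first by rewrite inf0.
by apply: lb_le_inf => // t [].
Qed.

Lemma critical_exponent_le t :
  0 <= t -> subcritical q t -> critical_exponent q <= t.
Proof.
move=> t0 sub; apply: inf_lbound; last by split.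
by exists 0 => u [].
Qed.

Lemma gt_critical_exponent (t0 t : R) : 0 <= t0 -> subcritical q t0 ->
  critical_exponent q < t -> subcritical q t.
Proof.
move=> t00 sub0 ct; have [u [u0 subu] ut] : exists2 u,
    0 <= u /\ subcritical q u & u < t.
  by apply: inf_lt => //; exists t0.
exact: subcritical_le (ltW ut) subu.
Qed.

Lemma lt_critical_exponent (t M : R) : 0 <= t -> t < critical_exponent q ->
  exists2 k, (0 < k)%N & M <= level_sum q k t.
Proof.
move=> t0 tc; have /andP[g0 g1] := g01.
pose d := (critical_exponent q - t) / 2; have d0 : 0 < d by rewrite /d; lra.
have tdc : t + d < critical_exponent q by rewrite /d; lra.
have : ~ subcritical q (t + d).
  move=> /critical_exponent_le; rewrite addr_ge0 ?(ltW d0)// => /(_ isT).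
  by rewrite leNgt tdc.
move=> /existsNP[e /not_implyP[e0 ne]].
have gd01 : 0 < g `^ d < 1.
  rewrite powR_gt0//=; have := @gt0_ltr_powR R d d0 g 1.
  by rewrite powR1; apply; rewrite ?nnegrE ?ltW.
have /andP[gd0 gd1] := gd01.
have M1 : 0 < e / (Num.max M 1) by rewrite divr_gt0// lt_max ltr01 orbT.
have : (fun n => (g `^ d) ^+ n) @ \oo --> (0 : R).
  by apply: cvg_expr; rewrite ger0_norm ?ltW.
move=> /cvgr0Pnorm_lt /(_ _ M1)[k _ /(_ k.+1 (leqnSn _))].
rewrite ger0_norm ?exprn_ge0 1?ltW// ltr_pdivlMr ?lt_max ?ltr01 ?orbT// => gk.
exists k.+1 => //; rewrite leNgt; apply/negP => lM; apply: ne.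
exists k.+1 => //; apply: le_lt_trans (level_sum_decay _ _ _ (ltW d0) t0) _.
apply: le_lt_trans gk; rewrite ler_wpM2l ?exprn_ge0 1?ltW//.
by rewrite lt_max lM.
Qed.

End one_weight.

(* Passing from [q] to [q'] costs at most the factor [l ^+ k] at level [k],
   which a shift of the exponent by [d] absorbs when [l `^ 2 * g `^ d <= 1]. *)
Lemma critical_exponent_perturb (q q' : seq 'I_N -> R) (t0 l g d : R) :
  0 < g < 1 -> 1 <= l -> 0 <= d <= 1 -> l ^+ 2 * g `^ d <= 1 ->
  (forall w, 0 < q w <= g ^+ size w) -> (forall w, 0 < q' w <=
    l ^+ size w * q w) ->
  0 <= t0 < 1 -> subcritical q t0 ->
  critical_exponent q' <= critical_exponent q + d.
Proof.
move=> g01 l1 /andP[d0 d1] lg qg ql /andP[t00 t01] sub0.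
have /andP[g0 g1] := g01; have l0 : 0 < l by lra.
have ct0 : critical_exponent q <= t0 by exact: critical_exponent_le.
have c0 := @critical_exponent_ge0 q.
apply/ler_addgt0Pr => e e0.
(* The cap at 1, with [d <= 1], gives [t + d <= 2], so that [l ^+ 2] dominates the loss per letter.
   The critical exponent stays below [t] because it is at most [t0 < 1]. *)
pose t := Num.min 1 (critical_exponent q + e).
have ct : critical_exponent q < t by rewrite lt_min; apply/andP; split; lra.
have t1 : t <= 1 by rewrite ge_min lexx.
have te : t <= critical_exponent q + e by rewrite ge_min lexx orbT.
apply: (@le_trans _ _ (t + d)); last by lra.
apply: critical_exponent_le; first by lra.
move=> e' e'0; have [k k0 ke'] :=
  gt_critical_exponent _ _ g01 qg _ _ t00 sub0 ct e' e'0.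
exists k => //; apply: le_lt_trans ke'.
apply: le_trans (level_sum_shift _ _ _ _ _ _ _ qg ql l0 g0 d0 _) _;
  first by lra.
rewrite ler_piMl ?level_sum_ge0// exprn_ile1//;
  first by rewrite mulr_ge0 ?powR_ge0.
apply: le_trans lg; rewrite ler_wpM2r ?powR_ge0//.
by rewrite -powR_mulrn ?(ltW l0)// ler_powR//; lra.
Qed.

Lemma sum_word_weight (p : 'I_N -> R) k : \sum_j p j = 1 ->
  \sum_(w : k.-tuple 'I_N) word_weight p w = 1.
Proof.
move=> p1; elim: k => [|k ih].
  by rewrite (big_tuple0 _ _ _ _ (word_weight p)) /word_weight big_nil.
rewrite (big_tupleS _ _ _ _ _ (word_weight p)) -[RHS]p1.
apply: eq_bigr => j _; rewrite -[RHS]mulr1 -ih mulr_sumr.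
by apply: eq_bigr => v _; rewrite /word_weight big_cons.
Qed.

Lemma word_weight_ge (p : 'I_N -> R) (a : R) w : 0 <= a ->
  (forall j, a <= p j) -> a ^+ size w <= word_weight p w.
Proof.
move=> a0 ap; rewrite /word_weight; elim: w => [|j w ih];
  first by rewrite big_nil.
by rewrite big_cons exprS ler_pM// exprn_ge0.
Qed.

Lemma word_weight_le1 (p : 'I_N -> R) w :
  probability_vector p -> word_weight p w <= 1.
Proof.
move=> [p0 p1]; rewrite /word_weight; elim: w => [|j w ih];
  first by rewrite big_nil.
rewrite big_cons mulr_ile1 ?(ltW (p0 _))//; first by rewrite ltW//
  word_weight_gt0.
by rewrite -p1 (bigD1 j)//= lerDl sumr_ge0// => i _; exact: ltW.
Qed.

Lemma subcritical_lt1 (p : 'I_N -> R) (S : seq 'I_N -> R) (c r : R) :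
  probability_vector p -> 0 < r -> 0 < c < 1 ->
  (forall w, 0 < S w <= c ^+ size w) ->
  exists2 t : R, 0 <= t < 1 &
    subcritical (fun w => word_weight p w * S w `^ r) t.
Proof.
move=> [p0 p1] r0 /andP[c0 c1] Sc.
have [a /andP[a0 a1] ap] := @finite_lower_bound R _ p p0.
pose u := - ln a; pose v := - (r * ln c).
have u0 : 0 <= u by rewrite oppr_ge0 ln_le0.
have v0 : 0 < v by rewrite oppr_gt0 pmulr_rlt0// ln_lt0// c0.
(* [z < 1] means [(1 - t) * u < t * v], that is [t > u / (u + v)]; [t] is the midpoint between this
   threshold and 1. *)
pose t := (u *+ 2 + v) / ((u + v) *+ 2).
have uv0 : 0 < (u + v) *+ 2 by lra.
have t1 : t < 1 by rewrite ltr_pdivrMr// mul1r; lra.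
have t0 : 0 < t by rewrite divr_gt0//; lra.
exists t; first by rewrite ltW.
have tuv : (1 - t) * u < t * v.
  have -> : 1 - t = v / ((u + v) *+ 2) by rewrite /t; field; rewrite gt_eqF//;
    lra.
  rewrite /t mulrAC [X in _ < X]mulrAC ltr_pM2r ?invr_gt0//.
  by have := mulr_ge0 u0 (ltW v0); have := mulr_gt0 v0 v0; nra.
pose z := a `^ (t - 1) * c `^ (r * t).
have z0 : 0 < z by rewrite mulr_gt0// powR_gt0.
have z1 : z < 1.
  rewrite -ltr_ln ?posrE// ln1 lnM ?posrE ?powR_gt0// !ln_powR.
  by move: tuv; rewrite /u /v; lra.
have zk k : level_sum (fun w => word_weight p w * S w `^ r) k t <= z ^+ k.
  rewrite /level_sum.
  apply: (@le_trans _ _ (\sum_(w : k.-tuple 'I_N) word_weight p w * z ^+ k)).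
    apply: ler_sum => w _; have /andP[S0 Sk] := Sc w.
    have pw0 : 0 < word_weight p w by exact: word_weight_gt0.
    rewrite powRM ?powR_ge0 ?(ltW pw0)// -powRrM -(mulr_powRB1 (ltW pw0) t0).
    rewrite -mulrA ler_wpM2l ?(ltW pw0)//
      exprMn !powR_exprn ?(ltW a0) ?(ltW c0)//.
    apply: ler_pM; rewrite ?powR_ge0//; last first.
      apply: ler_powRl; [by rewrite mulr_ge0 ?ltW|exact: ltW|].
      by rewrite -[X in _ <= _ ^+ X](size_tuple w).
    rewrite -(opprB 1 t) !powRN lef_pV2 ?posrE ?powR_gt0 ?exprn_gt0//.
    apply: ler_powRl; [by rewrite subr_ge0 ltW|by rewrite exprn_ge0 ?ltW|].
    by rewrite -[X in _ ^+ X <= _](size_tuple w); apply: word_weight_ge => //;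
      exact: ltW.
  by rewrite -mulr_suml sum_word_weight// mul1r.
move=> e e0.
have : (fun n => z ^+ n) @ \oo --> (0 : R).
  by apply: cvg_expr; rewrite ger0_norm ?ltW.
move=> /cvgr0Pnorm_lt /(_ _ e0)[k _ /(_ k.+1 (leqnSn _))].
rewrite ger0_norm ?exprn_ge0 1?ltW// => zke.
by exists k.+1 => //; exact: le_lt_trans (zk _) zke.
Qed.

End critical_exponent.

(** * The quantization dimension of one system *)

Section quantization_dimension_bounds.
Context {R : realType} {X : pointedMetricType R}.
Variables (mu : probability (borel X) R) (r : R).
Hypothesis r0 : 0 < r.
Local Notation V m := (quantization_error m r mu).

Lemma quantization_error_ge0 m : (0 <= V m)%E.
Proof.
apply: le_ereal_inf_tmp => _ [A _ <-].
by apply: integral_ge0 => x _; exact: poweR_ge0.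
Qed.

Lemma quantization_quotient_le (m : nat) (D : R) : (1 < m)%N -> 0 < D ->
  (V m <= (m%:R `^ (- (r / D)))%:E)%E ->
  (0 <= (r * ln m%:R)%:E / - lne (V m) <= D%:E)%E.
Proof.
move=> m1 D0 VD; have m1R : 1 < m%:R :> R by rewrite ltr1n.
have lnm : 0 < ln m%:R :> R by rewrite ln_gt0.
have := quantization_error_ge0 m.
case VE : (V m) VD => [v| |]//; rewrite !lee_fin => vD.
(* If the error is 0, the quotient is 0 by the conventions on [lne] and the inverse. *)
rewrite le_eqVlt => /orP[/eqP <-|v0].
  by rewrite le0_lneNy// mule0 lexx lee_fin ltW.
have lnv : r / D * ln m%:R <= - ln v.
  rewrite lerNr -mulNr -ln_powR ler_ln// posrE powR_gt0//; lra.
have lnv0 : 0 < - ln v.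
  by apply: lt_le_trans lnv; rewrite !mulr_gt0 ?invr_gt0.
rewrite lne_EFin// -EFinN inver gt_eqF// -EFinM !lee_fin.
apply/andP; split; first by rewrite divr_ge0 ?mulr_ge0 ?ltW.
by rewrite ler_pdivrMr// -ler_pdivrMl// mulrA [_^-1 * r]mulrC.
Qed.

(** The upper bound with [D'] ensures that [- ln v] is positive, so that the lower bound on the
    error can be divided by it. *)
Lemma quantization_quotient_ge (m : nat) (D D' : R) : (1 < m)%N -> 0 < D ->
  0 < D' -> (V m <= (m%:R `^ (- (r / D')))%:E)%E ->
  ((m%:R `^ (- (r / D)))%:E <= V m)%E ->
  (D%:E <= (r * ln m%:R)%:E / - lne (V m))%E.
Proof.
move=> m1 D0 D'0 VD'; have m1R : 1 < m%:R :> R by rewrite ltr1n.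
have m0 : 0 < m%:R :> R by lra.
have lnm : 0 < ln m%:R :> R by rewrite ln_gt0.
case VE : (V m) VD' => [v| |]//; rewrite !lee_fin => vD' vD.
have v0 : 0 < v by apply: lt_le_trans vD; rewrite powR_gt0.
have lnv' : r / D' * ln m%:R <= - ln v.
  by rewrite lerNr -mulNr -ln_powR ler_ln// posrE powR_gt0.
have lnv : - ln v <= r / D * ln m%:R.
  by rewrite lerNl -mulNr -ln_powR ler_ln// posrE powR_gt0.
have lnv0 : 0 < - ln v.
  by apply: lt_le_trans lnv'; rewrite !mulr_gt0 ?invr_gt0.
rewrite lne_EFin// -EFinN inver gt_eqF// -EFinM lee_fin.
by rewrite ler_pdivlMr// -ler_pdivlMl// mulrA [_^-1 * r]mulrC.
Qed.

Lemma is_quantization_dimension_bounds (D : R) : 0 <= D ->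
  (forall D', D < D' -> \forall m \near \oo,
    (V m <= (m%:R `^ (- (r / D')))%:E)%E) ->
  (forall D', 0 < D' < D -> \forall m \near \oo,
    ((m%:R `^ (- (r / D')))%:E <= V m)%E) ->
  is_quantization_dimension r mu D.
Proof.
move=> D0 VD DV; have near1 : \forall m \near \oo,
  (1 < m)%N by exact: nbhs_infty_gt.
have bounds e : 0 < e -> \forall m \near \oo,
    ((D - e)%:E <= (r * ln m%:R)%:E / - lne (V m) <= (D + e)%:E)%E.
  move=> e0; have De : D < D + e by lra.
  have De0 : 0 < D + e by lra.
  (* When [D - e <= 0], in particular when [D = 0], the lower estimate is just the nonnegativity of
     the quotient. *)
  have [eD|eD] := ltP 0 (D - e).
    have eDD : 0 < D - e < D by lra.
    near=> m; apply/andP; split.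
      apply: (@quantization_quotient_ge _ _ (D + e)) => //.
      - by near: m.
      - by near: m; exact: VD.
      - by near: m; exact: DV.
    have m1 : (1 < m)%N by near: m.
    have VDm : (V m <= (m%:R `^ (- (r / (D + e))))%:E)%E by near: m; exact: VD.
    by have /andP[] := quantization_quotient_le m (D + e) m1 De0 VDm.
  near=> m.
  have m1 : (1 < m)%N by near: m.
  have VDm : (V m <= (m%:R `^ (- (r / (D + e))))%:E)%E by near: m; exact: VD.
  have /andP[Q0 ->] := quantization_quotient_le m (D + e) m1 De0 VDm.
  by rewrite andbT; apply: le_trans Q0; rewrite lee_fin.
apply/fine_cvgP; split.
  have := bounds 1 ltr01; apply: filterS => m /andP[l u].
  by rewrite fin_numElt (lt_le_trans _ l) ?ltNyr// (le_lt_trans u) ?ltry.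
apply/cvgrPdist_le => e e0; have := bounds e e0; apply: filterS => m /=.
case: (_ / _)%E => [x| |]/=.
- by rewrite !lee_fin ler_distlC => /andP[-> ->].
- by rewrite andbC.
- by [].
Unshelve. all: by end_near. Qed.

End quantization_dimension_bounds.

Lemma powR_eventually_ge (R : realType) (e M : R) : 0 < e ->
  \forall m \near \oo, M <= m%:R `^ e.
Proof.
move=> e0; have [M0|M0] := leP M 0.
  by apply: nearW => m; rewrite (le_trans M0)// powR_ge0.
have := nbhs_infty_ger (M `^ e^-1); apply: filterS => m Mm.
apply: le_trans (ler_powRl _ e _ _ (ltW e0) _ Mm); last exact: powR_ge0.
by rewrite -powRrM mulVf ?gt_eqF// powRr1// ltW.
Qed.

(** * Extremal distances in a compact space *)

Section compact_metric.
Context {R : realType} {X : metricType R}.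

Lemma mdist_continuous (g h : X -> X) : continuous g -> continuous h ->
  continuous (fun z : X * X => mdist (g z.1) (h z.2)).
Proof.
move=> cg ch [x y]; apply/cvgrPdist_lt => e e0.
have e20 : 0 < e / 2 by rewrite divr_gt0.
have near_g : \forall z \near (x, y), mdist (g x) (g z.1) < e / 2.
  have : {for (x, y), continuous (g \o @fst X X)}.
    by apply: continuous_comp; [exact: cvg_fst|exact: cg].
  by move=> /metricType_numDomainType.cvgr_dist_lt; exact.
have near_h : \forall z \near (x, y), mdist (h y) (h z.2) < e / 2.
  have : {for (x, y), continuous (h \o @snd X X)}.
    by apply: continuous_comp; [exact: cvg_snd|exact: ch].
  by move=> /metricType_numDomainType.cvgr_dist_lt; exact.
near=> z.
have gz : mdist (g x) (g z.1) < e / 2 by near: z.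
have hz : mdist (h y) (h z.2) < e / 2 by near: z.
rewrite /= ltr_norml.
have := metric_triangle (g x) (g z.1) (h y).
have := metric_triangle (g z.1) (h z.2) (h y).
have := metric_triangle (g z.1) (g x) (h z.2).
have := metric_triangle (g x) (h y) (h z.2).
by rewrite (metric_sym (g z.1) (g x)) (metric_sym (h z.2) (h y)); lra.
Unshelve. all: by end_near. Qed.

Hypothesis compactX : compact [set: X].

Let compactXX : compact [set: X * X].
Proof. by rewrite -setXTT; exact: compact_setX. Qed.

Lemma compact_metric_bounded (x0 : X) :
  exists2 M : R, 0 < M & forall x y : X, mdist x y <= M.
Proof.
have cid : continuous (fun x : X => x) by move=> x.
have [[x y] _ xyM] := @compact_EVT_max _ R _ _ (ex_intro _ (x0, x0) I) compactXX
  (continuous_subspaceT (mdist_continuous _ _ cid cid)).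
exists (mdist x y + 1) => [|a b]; first by rewrite ltr_wpDl// mdist_ge0.
have ab : mdist a b <= mdist x y by exact: (xyM (a, b) (mem_set I)).
by rewrite (le_trans ab)// lerDl.
Qed.

Lemma compact_image_separated (g h : X -> X) (x0 : X) :
  continuous g -> continuous h -> (forall x y, g x <> h y) ->
  exists2 d : R, 0 < d & forall x y, d <= mdist (g x) (h y).
Proof.
move=> cg ch gh.
have [[x y] _ xyM] := @compact_EVT_min _ R _ _ (ex_intro _ (x0, x0) I) compactXX
  (continuous_subspaceT (mdist_continuous _ _ cg ch)).
exists (mdist (g x) (h y)) => [|a b]; last exact: (xyM (a, b) (mem_set I)).
by rewrite mdist_gt0; apply/eqP; exact: gh.
Qed.

End compact_metric.

Lemma powR_eventually_le (R : realType) (M a b : R) : a < b ->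
  \forall m \near \oo, M * m%:R `^ a <= m%:R `^ b.
Proof.
move=> ab; have ba : 0 < b - a by rewrite subr_gt0.
have := powR_eventually_ge _ _ M ba.
have : \forall m \near \oo, (0 < m)%N by exact: nbhs_infty_gt.
apply: filterS2 => m m0 Mm.
rewrite -(subrK a b) powRD ?ler_wpM2r ?powR_ge0//.
by rewrite (gt_eqF (_ : 0 < m%:R)) ?implybT// ltr0n.
Qed.

(** * Consequences of contraction and of the open set condition *)

Section open_set_condition.
Context {R : realType} {X : metricType R} {N : nat}.
Variables (f : 'I_N -> X -> X) (c : R).
Hypotheses (c01 : 0 < c < 1).
Hypothesis fc : forall j x y, mdist (f j x) (f j y) <= c * mdist x y.

Lemma word_map_lipschitz w x y :
  mdist (word_map f w x) (word_map f w y) <= c ^+ size w * mdist x y.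
Proof.
have /andP[c0 _] := c01.
elim: w => [|j w ih] /=; first by rewrite mul1r.
by rewrite (le_trans (fc _ _ _))// exprS -mulrA ler_pM2l.
Qed.

Lemma attractor_address (E : set X) k x : attractor f E -> E x ->
  exists2 w : seq 'I_N, size w = k & exists y, word_map f w y = x.
Proof.
move=> [_ _ EE]; elim: k x => [|k ih] x Ex; first by exists [::] => //;
  exists x.
move: Ex; rewrite EE => -[j _ [y Ey <-]].
by have [w <- [z <-]] := ih y Ey; exists (j :: w) => //; exists z.
Qed.

(** A point [z] of the attractor lying in [G] belongs to an image [f_u(X)] at every level. The
    diameter of that image is at most [c ^+ size u * M], so a long [u] keeps it inside a ball around
    [z] contained in [G]. *)
Lemma sosc_word (M : R) : (forall x y : X, mdist x y <= M) ->
  strong_open_set_condition f ->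
  exists (G : set X) (u : seq 'I_N),
  [/\ \bigcup_j (f j @` G) `<=` G,
      forall i j, i != j -> (f i @` G) `&` (f j @` G) = set0 &
      forall x, G (word_map f u x)].
Proof.
move=> XM [G [E [[oG _ _] [fG dG attE [z [Ez Gz]]]]]].
have /andP[c0 c1] := c01.
have : nbhs z G by apply: open_nbhs_nbhs.
rewrite -metricType_numDomainType.nbhs_nbhs_mdist => -[e /= e0 eG].
have M1 : 0 < e / Num.max M 1 by rewrite divr_gt0// lt_max ltr01 orbT.
have : (fun n => c ^+ n) @ \oo --> (0 : R).
  by apply: cvg_expr; rewrite ger0_norm ?ltW.
move=> /cvgr0Pnorm_lt /(_ _ M1)[k _ /(_ k (leqnn _))].
rewrite ger0_norm ?exprn_ge0 1?ltW// ltr_pdivlMr ?lt_max ?ltr01 ?orbT// => ck.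
have [u uk [y uyz]] := attractor_address E k z attE Ez.
exists G, u; split => // x; apply: eG => /=.
rewrite -uyz (le_lt_trans (word_map_lipschitz _ _ _))// uk.
apply: le_lt_trans ck; rewrite ler_wpM2l ?le_max ?XM//.
by rewrite exprn_ge0// ltW.
Qed.

(** Injectivity strips the common prefix; at the first differing letter the two points lie in
    disjoint images of [G]. *)
Lemma word_map_disjoint (G : set X) (w v : seq 'I_N) x y :
  (forall j, injective (f j)) -> \bigcup_j (f j @` G) `<=` G ->
  (forall i j, i != j -> (f i @` G) `&` (f j @` G) = set0) ->
  size w = size v -> w <> v -> G x -> G y -> word_map f w x <> word_map f v y.
Proof.
move=> finj fG dG.
have wG u z : G z -> G (word_map f u z).
  elim: u z => [|j u ih] z Gz //=.
  by apply: fG; exists j => //; exists (word_map f u z) => //; exact: ih.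
elim: w v => [|i w ih] [|j v]//= [sz] wv Gx Gy.
have [ij|ij] := eqVneq i j.
  by subst j => /finj; apply: ih => // wv'; apply: wv; rewrite wv'.
move=> fij; have /seteqP[+ _] := dG i j ij; apply; split.
  by exists (word_map f w x) => //; exact: wG.
by rewrite fij; exists (word_map f v y) => //; exact: wG.
Qed.

End open_set_condition.

(** * Systems whose word maps are similarities up to a uniform factor *)

Section quasi_self_similar.
Context {R : realType} {X : pointedMetricType R} {N : nat}.
Variables (f : 'I_N -> X -> X) (p : 'I_N -> R) (mu : probability (borel X) R).
Variables (S : seq 'I_N -> R) (K c r : R) (a b : X).
Hypotheses (compactX : compact [set: X]) (ab : a != b).
Hypotheses (probp : probability_vector p) (inv : invariant_measure f p mu).
Hypotheses (r0 : 0 < r) (c01 : 0 < c < 1) (K0 : 0 < K).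
Hypothesis fc : forall j x y, mdist (f j x) (f j y) <= c * mdist x y.
Hypothesis Sc : forall w, 0 < S w <= c ^+ size w.
Hypothesis fS : forall w x y,
  S w / K * mdist x y <= mdist (word_map f w x) (word_map f w y)
    <= K * S w * mdist x y.
Hypothesis sosc : strong_open_set_condition f.

Let q w := word_weight p w * S w `^ r.

Let p0 j : 0 < p j. Proof. exact: probp.1. Qed.
Let S0 w : 0 < S w. Proof. by have /andP[] := Sc w. Qed.
Let pw0 w : 0 < word_weight p w. Proof. exact: word_weight_gt0. Qed.
Let q0 w : 0 < q w. Proof. by rewrite mulr_gt0// powR_gt0. Qed.
Let cf j : continuous (f j). Proof. exact: lipschitz_continuous (fc j). Qed.

Lemma quasi_self_similar_le w : 0 < q w <= (c `^ r) ^+ size w.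
Proof.
have /andP[c0 _] := c01; rewrite q0/= powR_exprn ?(ltW c0)//.
apply: (@le_trans _ _ (S w `^ r)).
  by rewrite ler_piMl ?powR_ge0//; exact: word_weight_le1.
by apply: ler_powRl; [exact: ltW|exact: ltW|have /andP[] := Sc w].
Qed.

(** Both sides are compared with the distance between the images of [a] and [b] under [f_w \o f_v]:
    each of the three uses of [fS] costs one factor [K]. *)
Lemma quasi_self_similar_cat w v : S w * S v / K ^+ 3 <= S (w ++ v).
Proof.
have dab : 0 < mdist a b by rewrite mdist_gt0.
have /andP[_ h1] := fS (w ++ v) a b.
have /andP[h2 _] := fS w (word_map f v a) (word_map f v b).
have /andP[h3 _] := fS v a b.
rewrite word_map_cat/= in h1.
have h4 := le_trans h2 h1.
have h5 : S w / K * (S v / K * mdist a b) <= K * S (w ++ v) * mdist a b.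
  by apply: le_trans h4; rewrite ler_wpM2l// divr_ge0// ltW.
rewrite ler_pdivrMr ?exprn_gt0//.
move: h5; rewrite !mulrA ler_pM2r// -(ler_pM2r (mulr_gt0 K0 K0)).
suff -> : S w / K * S v / K * (K * K) = S w * S v.
  by move=> /le_trans; apply; rewrite le_eqVlt; apply/orP; left; apply/eqP;
    ring.
by field; rewrite gt_eqF.
Qed.

Lemma word_map_inj w : injective (word_map f w).
Proof.
move=> x y xy; apply/eqP/negPn/negP => nxy.
have /andP[+ _] := fS w x y; rewrite xy mdistxx leNgt => /negP; apply.
by rewrite mulr_gt0 ?mdist_gt0// divr_gt0.
Qed.

Lemma quantization_error_upper (t : R) : 0 < t < 1 -> subcritical q t ->
  exists C D : R, [/\ 0 < C, 0 < D & forall m : nat, C <= m%:R ->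
    (quantization_error m r mu <= (D * (m%:R / C) `^ (1 - t^-1))%:E)%E].
Proof.
move=> t01 sub; have /andP[t0 t1] := t01.
have [k k0 kK] := sub (K `^ (- (r * t))) (powR_gt0 _ K0).
have [M M0 XM] := compact_metric_bounded compactX point.
have pq (w : k.-tuple 'I_N) : (word_weight p w * (K * S w) `^ r) `^ t =
    K `^ (r * t) * q w `^ t.
  have -> : word_weight p w * (K * S w) `^ r = K `^ r * q w.
    by rewrite /q (powRM _ (ltW K0) (ltW (S0 w))) mulrCA.
  by rewrite powRM ?powR_ge0 ?(ltW (q0 w))// -powRrM.
have sum1 : \sum_(w : k.-tuple 'I_N)
    (word_weight p w * (K * S w) `^ r) `^ t < 1.
  under eq_bigr do rewrite pq.
  by rewrite -mulr_sumr mulrC -ltr_pdivlMr ?powR_gt0// mul1r -powRN.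
have [||||||C [D [C0 D0 CD]]] := @quantization_upper R X (k.-tuple 'I_N)
  (fun w => word_map f w) (fun w => word_weight p w) (fun w => K * S w) mu r t M
  r0 t01 _ _ M0 XM.
- by move=> w; exact: pw0.
- by move=> w; rewrite mulr_gt0.
- by move=> w x y; have /andP[] := fS w x y.
- by move=> g mg g0; exact: invariant_integral_word.
- move=> w; rewrite ltNge; apply/negP => w1.
  move: sum1; rewrite ltNge => /negP; apply.
  rewrite (bigD1 w)//= -[leLHS]addr0 lerD ?sumr_ge0//; last by move=> v _;
    exact: powR_ge0.
  by rewrite -[leLHS](powRr0 (word_weight p w * (K * S w) `^ r)) ler_powR// ltW.
- exact: (ltW sum1).
exists C, D; split => // m Cm.
have mC : 1 <= m%:R / C by rewrite ler_pdivlMr// mul1r.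
have [|J [g [Jm gD]]] := CD ((m%:R / C) `^ t^-1).
  have := @ler_powR R (m%:R / C) mC 0 t^-1; rewrite powRr0; apply.
  by rewrite invr_ge0 ltW.
move: Jm gD; rewrite -!powRrM mulVf ?gt_eqF// powRr1 ?(le_trans ler01)//.
rewrite mulrC divfK ?gt_eqF// ler_nat mulrBr mulr1 mulVf ?gt_eqF// => Jm.
apply: le_trans; apply: ereal_inf_lbound; exists (range g) => //=.
by apply: card_le_trans (card_image_le _ _) _; rewrite card_le_fin.
Qed.

Lemma quantization_error_lower (t : R) : 0 < t ->
  (forall M : R, exists2 k, (0 < k)%N & M <= level_sum q k t) ->
  exists2 C : R, 0 < C & forall m : nat, (0 < m)%N ->
    ((C * m%:R `^ (1 - t^-1))%:E <= quantization_error m r mu)%E.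
Proof.
move=> t0 big; have /andP[c0 c1] := c01.
have [M M0 XM] := compact_metric_bounded compactX point.
have [G [u [fG dG uG]]] := sosc_word f c c01 fc M XM sosc.
pose e := word_weight p u * (S u / K ^+ 4) `^ r.
have e0 : 0 < e by rewrite mulr_gt0// powR_gt0// divr_gt0// exprn_gt0.
have [k k0 ke] := big (e `^ (- t)).
(* For two distinct words the images are disjoint and compact, hence at positive distance; the
   minimum over the finitely many pairs is taken. *)
have [d d0 Fd] : exists2 d : R, 0 < d & forall (w v : k.-tuple 'I_N) x y,
  w != v ->
    d <= mdist (word_map f (w ++ u) x) (word_map f (v ++ u) y).
  have /choice[d dP] : forall wv : k.-tuple 'I_N * k.-tuple 'I_N,
      exists d : R, 0 < d /\ (wv.1 != wv.2 -> forall x y,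
      d <= mdist (word_map f (wv.1 ++ u) x) (word_map f (wv.2 ++ u) y)).
    move=> [w v] /=; have [->|wv] := eqVneq w v; first by exists 1;
      rewrite ltr01.
    have [||x y|d d0 dP] := compact_image_separated compactX
      (word_map f (w ++ u)) (word_map f (v ++ u)) point.
    - exact: word_map_continuous.
    - exact: word_map_continuous.
    - rewrite !word_map_cat/=.
      apply: (word_map_disjoint f G) => //; last by move=> /val_inj; exact/eqP.
      + by move=> j; exact: (word_map_inj [:: j]).
      + by rewrite !size_tuple.
    by exists d.
  have [d' /andP[d'0 _] d'P] := @finite_lower_bound R _ d (fun wv => (dP wv).1).
  exists d' => // w v x y wv; apply: le_trans (d'P (w, v)) _.
  by have [_] := dP (w, v); exact.
pose B (w : seq 'I_N) := S (w ++ u) / K.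
have B0 w : 0 < B w by rewrite divr_gt0.
have Bc (w : k.-tuple 'I_N) : B w <= c.
  have dab : 0 < mdist a b by rewrite mdist_gt0.
  have /andP[h _] := fS (w ++ u) a b.
  rewrite -(ler_pM2r dab) (le_trans h)//
    (le_trans (word_map_lipschitz f c c01 fc _ _ _))//.
  rewrite ler_pM2r// size_cat size_tuple -(prednK k0) addSn exprS.
  by rewrite ler_piMr ?(ltW c0)// exprn_ile1// ltW.
have [||||||||C C0 CP] := @quantization_lower R X (k.-tuple 'I_N)
  (fun w => word_map f (w ++ u)) (fun w => word_weight p (w ++ u)) B mu r t d
  compactX t0 _ d0.
- by move=> w; exact: pw0.
- by move=> w; rewrite B0 (le_trans (Bc w))// ltW.
- by move=> w; exact: word_map_continuous.
- by move=> w x y; have /andP[] := fS (w ++ u) x y.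
- exact: Fd.
- by move=> w A mA; exact: invariant_measure_word.
- move=> w; apply: (@le_lt_trans _ _ (B w `^ r)).
    by rewrite ler_piMl ?powR_ge0//; exact: word_weight_le1.
  have := @gt0_ltr_powR R r r0 (B w) 1; rewrite powR1; apply.
  + by rewrite nnegrE ltW.
  + by rewrite nnegrE.
  + exact: le_lt_trans (Bc w) c1.
- apply: (@le_trans _ _ (e `^ t * level_sum q k t)).
    by rewrite mulrC -ler_pdivrMr ?powR_gt0// mul1r -powRN.
  rewrite /level_sum mulr_sumr; apply: ler_sum => w _.
  rewrite -powRM ?(ltW e0) ?(ltW (q0 _))//.
  apply: ler_powRl; [exact: ltW|by rewrite mulr_ge0 ?ltW|].
  rewrite /e /q /word_weight big_cat/= -!/(word_weight p _).
  rewrite [_ * word_weight p u]mulrC -!mulrA ler_wpM2l ?(ltW (pw0 _))//.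
  rewrite mulrCA ler_wpM2l ?(ltW (pw0 _))//.
  rewrite -powRM ?(ltW (S0 _)) ?divr_ge0 ?exprn_ge0 ?(ltW K0) ?(ltW (S0 _))//.
  apply: ler_powRl; [exact: ltW| |].
    by rewrite mulr_ge0 ?divr_ge0 ?exprn_ge0 ?(ltW K0) ?(ltW (S0 _)).
  rewrite /B ler_pdivlMr// (le_trans _ (quasi_self_similar_cat w u))//.
  rewrite le_eqVlt; apply/orP; left; apply/eqP.
  by field; rewrite gt_eqF.
exists (C / 2 `^ t^-1) => [|m m0]; first by rewrite divr_gt0// powR_gt0.
have m0R : 0 < m%:R :> R by rewrite ltr0n.
have m1R : 1 <= m%:R :> R by rewrite ler1n.
(* This scale yields at least [2 * m] pieces, of which a set of [m] points misses at least [m]. *)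
pose s : R := (2 * m%:R) `^ t^-1.
have s1 : 1 <= s.
  have := @ler_powR R (2 * m%:R) _ 0 t^-1; rewrite powRr0; apply; first by lra.
  by rewrite invr_ge0 ltW.
have s0 : 0 < s by lra.
have [J [U [rho [sJ sepU]]]] := CP s s1.
apply: le_ereal_inf_tmp => _ [A Am <-].
apply: le_trans (separated_family_error mu r J U rho (C / s) m A r0 _ sepU Am);
  last first.
  by rewrite divr_ge0// ltW.
rewrite lee_fin.
have sm : 2 * m%:R <= #|J|%:R :> R.
  by move: sJ; rewrite /s -powRrM mulVf ?gt_eqF// powRr1// mulr_ge0// ltW.
apply: (@le_trans _ _ (m%:R * (C / s))); last first.
  by apply: ler_wpM2r; [rewrite divr_ge0// ltW|lra].
rewrite /s powRM ?(ltW m0R)// powRB; last by rewrite (gt_eqF m0R) implybT.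
rewrite powRr1 ?(ltW m0R)// le_eqVlt; apply/orP; left; apply/eqP.
by field; rewrite !gt_eqF ?powR_gt0.
Qed.

Lemma quasi_self_similar_dimension (t0 : R) : 0 <= t0 < 1 -> subcritical q t0 ->
  is_quantization_dimension r mu
    (r * critical_exponent q / (1 - critical_exponent q)).
Proof.
move=> /andP[t00 t01] sub0; set th := critical_exponent q.
have /andP[c0 c1] := c01.
have g01 : 0 < c `^ r < 1.
  rewrite powR_gt0//=; have := @gt0_ltr_powR R r r0 c 1; rewrite powR1.
  by apply; rewrite ?nnegrE ?ltW.
have th0 : 0 <= th by exact: critical_exponent_ge0.
have th1 : th < 1.
  by apply: le_lt_trans t01; exact: critical_exponent_le.
have D0 : 0 <= r * th / (1 - th) by rewrite divr_ge0 ?mulr_ge0 ?(ltW r0)//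
  subr_ge0 ltW.
apply: is_quantization_dimension_bounds => // [D' DD'|D' /andP[D'0 D'D]].
  have D'0 : 0 < D' by exact: le_lt_trans DD'.
  have rD' : 0 < r + D' by rewrite addr_gt0.
  (* This inverts [t |-> r * t / (1 - t)], so that [1 - t'^-1 = - (r / D')]. A [t] strictly between
     [th] and [t'] leaves a gap of exponents that absorbs the constants for large [m]. *)
  pose t' := D' / (r + D').
  have tht' : th < t'.
    by rewrite /t' ltr_pdivlMr//; move: DD'; rewrite ltr_pdivrMr ?subr_gt0//;
      lra.
  have t'1 : t' < 1 by rewrite /t' ltr_pdivrMr// mul1r ltrDr.
  pose t := (th + t') / 2.
  have t01' : 0 < t < 1 by rewrite /t; lra.
  have tt' : 0 < t < t' by rewrite /t; lra.
  have /andP[tgt0 tltt'] := tt'.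
  have [|C [D [C0 Dgt0 CD]]] := quantization_error_upper t t01'.
    apply: (gt_critical_exponent q _ g01 quasi_self_similar_le t0) => //.
    by rewrite -/th /t; lra.
  have tV : 1 - t^-1 < 1 - t'^-1 by rewrite ltrD2l ltrN2 ltf_pV2 ?posrE//; lra.
  have := powR_eventually_le _ (D * (C^-1) `^ (1 - t^-1)) _ _ tV.
  have := nbhs_infty_ger C; apply: filterS2 => m Cm hm.
  apply: le_trans (CD m Cm) _; rewrite lee_fin powRM ?invr_ge0 ?(ltW C0)//.
  rewrite [_ `^ _ * _]mulrC mulrA (le_trans hm)//.
  rewrite le_eqVlt; apply/orP; left; apply/eqP; congr (_ `^ _).
  by rewrite /t'; field; rewrite !gt_eqF.
have rD' : 0 < r + D' by rewrite addr_gt0.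
pose t' := D' / (r + D').
have t'th : t' < th.
  by rewrite /t' ltr_pdivrMr//; move: D'D; rewrite ltr_pdivlMr ?subr_gt0//; lra.
have t'0 : 0 < t' by rewrite divr_gt0.
pose t := (th + t') / 2.
have tgt0 : 0 < t by rewrite /t; lra.
have [|C C0 CP] := quantization_error_lower t tgt0.
  move=> M; apply: (lt_critical_exponent q _ g01 quasi_self_similar_le _ _ (ltW tgt0)).
  by rewrite -/th /t; lra.
have tV : 1 - t'^-1 < 1 - t^-1.
  by rewrite ltrD2l ltrN2 ltf_pV2 ?posrE// /t; lra.
have := powR_eventually_le _ C^-1 _ _ tV.
have : \forall m \near \oo, (0 < m)%N by exact: nbhs_infty_gt.
apply: filterS2 => m m0; rewrite ler_pdivrMl// => hm.
apply: le_trans (CP m m0); rewrite lee_fin (le_trans _ hm)//.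
rewrite le_eqVlt; apply/orP; left; apply/eqP; congr (_ `^ _).
by rewrite /t'; field; rewrite !gt_eqF.
Qed.

End quasi_self_similar.

(** * Derivatives along words *)

Section word_ratio.
Context {R : realType} {X : pointedMetricType R} {N : nat}.
Implicit Types (f : 'I_N -> X -> X).

(* The derivative of [word_map f w] at [x].  Taking the product as a definition
   avoids a chain rule for [similitude_ratio]: bounded distortion compares both
   quantities to the difference quotients at [x]. *)
Fixpoint word_ratio f (w : seq 'I_N) (x : X) : R :=
  if w is j :: v
  then similitude_ratio (f j) (word_map f v x) * word_ratio f v x else 1.

Lemma has_similitude_ratioP (g : X -> X) (x : X) : infinitesimal_similitude g ->
  has_similitude_ratio g x (similitude_ratio g x).
Proof. by move=> /(_ x) Dg; exact: (xgetPex 0 Dg). Qed.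

Lemma perfect_sequence (x : X) : perfect_set [set: X] ->
  exists2 v : nat -> X, v @ \oo --> x & forall m, x != v m.
Proof.
move=> [_ limX].
have : limit_point [set: X] x by rewrite limX.
move=> lx; have /choice[v vP] : forall m : nat, exists y,
    y != x /\ mdist x y < m.+1%:R^-1.
  move=> m; have [|y [yx _ xy]] := lx [set y | mdist x y < m.+1%:R^-1].
    rewrite -metricType_numDomainType.nbhs_nbhs_mdist.
    by exists m.+1%:R^-1 => //=; rewrite invr_gt0.
  by exists y.
exists v => [|m]; last by rewrite eq_sym; have [] := vP m.
apply/metricType_numDomainType.cvgrPdist_lt => e e0.
have := near_infty_natSinv_lt (PosNum e0); apply: filterS => m /=.
by apply: lt_trans; have [] := vP m.
Qed.

Section one_ifs.
Variables (f : 'I_N -> X -> X).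
Hypotheses (perfectX : perfect_set [set: X]).
Hypotheses (ifs_f : similitude_ifs f) (bd_f : bounded_distortion f).

Let Df j x : 0 < similitude_ratio (f j) x.
Proof. by have [] := ifs_f j. Qed.

Lemma word_ratio_gt0 w x : 0 < word_ratio f w x.
Proof. by elim: w => //= j w ih; rewrite mulr_gt0. Qed.

Lemma similitude_ifs_contraction : exists2 c : R, 0 < c < 1 &
  forall j x y, mdist (f j x) (f j y) <= c * mdist x y.
Proof.
have /choice[d dP] : forall j, exists d : R, 0 <= d < 1 /\
    forall x y, mdist (f j x) (f j y) <= d * mdist x y.
  by move=> j; have [[d d01 dP] _ _ _] := ifs_f j; exists d.
have [j|c c01 dc] := @finite_upper_bound R _ d; first by case: (dP j) =>
  /andP[].
exists c => // j x y; have [_ /(_ x y)] := dP j.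
by move=> /le_trans; apply; rewrite ler_wpM2r// mdist_ge0.
Qed.

(** The lower distortion bound for a one-letter word is positive. *)
Lemma similitude_ifs_inj j : injective (f j).
Proof.
move=> x y xy; apply/eqP/negPn/negP => nxy.
have [C C0 /(_ [:: j] isT x y nxy)/= /andP[]] := bd_f.
rewrite xy mdistxx mul0r leNgt => /negP + _; apply.
by rewrite divr_gt0//; exact: Df.
Qed.

Let word_map_inj w : injective (word_map f w).
Proof.
by elim: w => [x y//|j w ih x y /=]; move=> /similitude_ifs_inj /ih.
Qed.

Lemma word_ratio_cvg w x (v : nat -> X) : v @ \oo --> x -> (forall m,
  x != v m) ->
  (fun m => mdist (word_map f w x) (word_map f w (v m)) / mdist x (v m)) @ \oo
    --> word_ratio f w x.
Proof.
move=> vx xv; have [c c01 fc] := similitude_ifs_contraction.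
have dxv m : mdist x (v m) != 0 by rewrite gt_eqF// mdist_gt0.
elim: w => [|j w ih] /=.
  under eq_fun do rewrite divff//.
  exact: cvg_cst.
have fxv m : word_map f w x != word_map f w (v m).
  by apply/eqP => /word_map_inj/eqP; exact/negP.
have cfw : continuous (word_map f w).
  by apply: word_map_continuous => i; exact: lipschitz_continuous (fc i).
have [_ sim_f _ _] := ifs_f j.
(* The derivative of [f j] is tested on a constant sequence and on the image of [v]; injectivity
   keeps their terms distinct, and the quotients then multiply as in a chain rule. *)
have := has_similitude_ratioP (f j) (word_map f w x) sim_f
  (fun=> word_map f w x) (word_map f w \o v) fxv (cvg_cst _) (cvg_comp _ _ vx (cfw x)).
move=> /(_ _) h; apply: (cvg_trans _ (cvgM h ih)); apply: near_eq_cvg;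
  apply: nearW => m /=.
rewrite mulrA divfK// gt_eqF// mdist_gt0//; exact: fxv.
Qed.

(** Difference quotients are symmetric in their two points, so bounded distortion makes the values
    of [similitude_ratio (word_map f w)] comparable up to [C ^+ 2]. The product at [point] is a
    limit of such quotients, which costs one more [C], and returning to a quotient costs a
    fourth. *)
Lemma bilipschitz_word : exists2 K : R, 0 < K & forall w x y,
  word_ratio f w point / K * mdist x y <=
    mdist (word_map f w x) (word_map f w y)
    <= K * word_ratio f w point * mdist x y.
Proof.
have [v vx xv] := perfect_sequence point perfectX.
have [C C0 bd] := bd_f.
have C40 : 0 < C ^+ 4 by rewrite exprn_gt0.
(* The summand 1 serves the empty word, about which bounded distortion says nothing. *)
exists (1 + C ^+ 4) => [|w x y]; first by rewrite addr_gt0.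
have [->|xy] := eqVneq x y; first by rewrite !mdistxx !mulr0 lexx.
have dxy : 0 < mdist x y by rewrite mdist_gt0.
have [->|w0] := eqVneq w [::].
  rewrite /= mulr1 mul1r ler_peMl ?(ltW dxy)//; last by rewrite lerDl ltW.
  rewrite andbT -ler_pdivlMr// divff ?gt_eqF//.
  by rewrite invf_le1 ?addr_gt0// lerDl ltW.
pose D := similitude_ratio (word_map f w).
pose W := word_ratio f w point.
pose Q x y := mdist (word_map f w x) (word_map f w y) / mdist x y.
have QC a b : a != b -> D a / C <= Q a b <= C * D a by exact: bd.
have Qs a b : Q a b = Q b a.
  by rewrite /Q [mdist a b]metric_sym [X in X / _]metric_sym.
have W0 : 0 < W by exact: word_ratio_gt0.
have cW := word_ratio_cvg w point v vx xv.
have DW1 : W <= C * D point.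
  apply: ler_cvg_to cW (cvg_cst _) _; apply: nearW => m.
  by have /andP[] := QC _ _ (xv m).
have DW2 : D point / C <= W.
  apply: ler_cvg_to (cvg_cst _) cW _; apply: nearW => m.
  by have /andP[] := QC _ _ (xv m).
have D0 : 0 < D point by rewrite -(pmulr_rgt0 _ C0) (lt_le_trans W0).
have DD a b : D a <= C ^+ 2 * D b.
  have [->|ab] := eqVneq a b.
    have [z bz] : exists z, b != z.
      have [bp|bp] := eqVneq b point; last by exists point.
      by exists (v 0%N); rewrite bp.
    have /andP[/le_trans h1 /h1] := QC _ _ bz.
    by rewrite ler_pdivrMr// mulrC mulrA.
  have /andP[h1 _] := QC _ _ ab.
  have /andP[_ h2] : D b / C <= Q a b <= C * D b by rewrite Qs; apply: QC;
    rewrite eq_sym.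
  by have := le_trans h1 h2; rewrite ler_pdivrMr// mulrC mulrA.
have /andP[Q1 Q2] := QC _ _ xy.
have Dx1 : D x <= C ^+ 3 * W.
  rewrite (le_trans (DD x point))//
    [C ^+ 3]exprSr -mulrA ler_wpM2l ?exprn_ge0 ?(ltW C0)//.
  by rewrite -ler_pdivrMl// mulrC.
have Dx2 : W <= C ^+ 3 * D x.
  by rewrite (le_trans DW1)// [C ^+ 3]exprS -mulrA ler_pM2l.
apply/andP; split.
  rewrite -ler_pdivlMr// -/(Q x y).
  apply: le_trans Q1; rewrite ler_pdivrMr ?addr_gt0// mulrAC ler_pdivlMr//.
  have h : W * C <= C ^+ 4 * D x by rewrite mulrC exprS -mulrA ler_pM2l.
  by rewrite (le_trans h)// mulrC ler_wpM2l// ?lerDr//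
    -(pmulr_rge0 _ (exprn_gt0 3 C0)) (le_trans (ltW W0)).
rewrite -ler_pdivrMr// -/(Q x y) (le_trans Q2)//;
  apply: (@le_trans _ _ (C ^+ 4 * W)).
  by rewrite exprS -mulrA ler_pM2l.
by rewrite ler_wpM2r ?(ltW W0)// lerDr.
Qed.

Lemma similitude_ratio_le c j x :
  (forall x y, mdist (f j x) (f j y) <= c * mdist x y) ->
  similitude_ratio (f j) x <= c.
Proof.
move=> fc; have [v vx xv] := perfect_sequence x perfectX.
have := word_ratio_cvg [:: j] x v vx xv; rewrite /= mulr1 => h.
apply: ler_cvg_to h (cvg_cst _) _; apply: nearW => m /=.
by rewrite ler_pdivrMr ?mdist_gt0.
Qed.

Lemma word_ratio_le c w x : 0 < c ->
  (forall j x y, mdist (f j x) (f j y) <= c * mdist x y) ->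
  word_ratio f w x <= c ^+ size w.
Proof.
move=> c0 fc; elim: w => [|j w ih] //=.
rewrite exprS ler_pM// ?(ltW (Df _ _)) ?(ltW (word_ratio_gt0 _ _))//.
exact: similitude_ratio_le (fc j).
Qed.

(** Distortion of one-letter words compares the derivative at any point with that at [point] up to
    [C ^+ 2]; finitely many positive values remain. *)
Lemma similitude_ratio_lower_bound :
  exists2 a : R, 0 < a & forall j x, a <= similitude_ratio (f j) x.
Proof.
have [C C0 bd] := bd_f.
have [v vx xv] := perfect_sequence point perfectX.
have DD j x : similitude_ratio (f j) point / Num.max 1 (C ^+ 2) <=
  similitude_ratio (f j) x.
  have m0 : 0 < Num.max 1 (C ^+ 2) by rewrite lt_max ltr01.
  rewrite ler_pdivrMr// mulrC.
  have [->|xp] := eqVneq x point.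
    by rewrite ler_peMl ?(ltW (Df _ _))// le_max lexx.
  apply: (@le_trans _ _ (C ^+ 2 * similitude_ratio (f j) x)); last first.
    by rewrite ler_wpM2r ?(ltW (Df _ _))// le_max lexx orbT.
  have /andP[_ h1] := bd [:: j] isT _ _ xp.
  rewrite eq_sym in xp; have /andP[h2 _] := bd [:: j] isT _ _ xp.
  rewrite [mdist x _]metric_sym [X in X / _]metric_sym in h1.
  by have := le_trans h2 h1; rewrite ler_pdivrMr// mulrC mulrA.
have [j|a /andP[a0 _] aP] := @finite_lower_bound R _
    (fun j => similitude_ratio (f j) point / Num.max 1 (C ^+ 2)).
  by rewrite divr_gt0// lt_max ltr01.
by exists a => // j x; exact: le_trans (aP j) (DD j x).
Qed.

End one_ifs.
End word_ratio.

(** The weight [q_w], with [point] as base point. *)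
Definition ifs_weight {R : realType} {X : pointedMetricType R} {N : nat}
    (r : R) (f : 'I_N -> X -> X) (p : 'I_N -> R) (w : seq 'I_N) : R :=
  word_weight p w * word_ratio f w point `^ r.

Lemma ifs_quantization_dimension (R : realType) (X : pointedMetricType R)
    (N : nat) (f : 'I_N -> X -> X) (p : 'I_N -> R)
    (mu : probability (borel X) R) (r : R) :
  compact [set: X] -> perfect_set [set: X] ->
  probability_vector p -> similitude_ifs f -> bounded_distortion f ->
  strong_open_set_condition f -> invariant_measure f p mu -> 0 < r ->
  let th := critical_exponent (ifs_weight r f p) in
  [/\ exists2 g : R, 0 < g < 1 & forall w, 0 < ifs_weight r f p w <=
    g ^+ size w,
      exists2 t : R, 0 <= t < 1 & subcritical (ifs_weight r f p) t &
      is_quantization_dimension r mu (r * th / (1 - th))].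
Proof.
move=> compactX perfectX prob_p ifs_f bd_f sosc inv r0.
have [c c01 fc] := similitude_ifs_contraction f ifs_f.
have /andP[c0 c1] := c01.
have [K K0 fK] := bilipschitz_word f perfectX ifs_f bd_f.
have Sc w : 0 < word_ratio f w point <= c ^+ size w.
  by rewrite word_ratio_gt0//=; exact: word_ratio_le.
have [v vx xv] := perfect_sequence point perfectX.
have [t t01 sub] := subcritical_lt1 _ _ c r prob_p r0 c01 Sc.
have wg w := quasi_self_similar_le p _ c r prob_p r0 c01 Sc w.
split.
- exists (c `^ r) => //; rewrite powR_gt0//=.
  have := @gt0_ltr_powR R r r0 c 1; rewrite powR1.
  by apply; rewrite ?nnegrE ?ltW.
- by exists t.
- exact: (quasi_self_similar_dimension f p mu _ K c r _ _ compactX (xv 0%N)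
    prob_p inv r0 c01 K0 fc Sc fK sosc t).
Qed.

(** * Dependence on the system *)

Section perturbation.
Context {R : realType} {X : pointedMetricType R} {N : nat}.
Variables (f_ : nat -> 'I_N -> X -> X) (p_ : nat -> 'I_N -> R).
Variables (f : 'I_N -> X -> X) (p : 'I_N -> R) (r : R).
Hypotheses (perfectX : perfect_set [set: X]) (r0 : 0 < r).
Hypotheses (prob_p_ : forall n, probability_vector (p_ n)).
Hypotheses (prob_p : probability_vector p).
Hypotheses (ifs_f_ : forall n,
  similitude_ifs (f_ n)) (ifs_f : similitude_ifs f).
Hypotheses (bd_f : bounded_distortion f).
Hypothesis cvg_f : forall j, {uniform, (fun n => f_ n j) @ \oo --> f j}.
Hypothesis cvg_p : forall j, (fun n => p_ n j) @ \oo --> p j.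
Hypothesis cvg_Df : forall j, {uniform,
    (fun n => similitude_ratio (f_ n j)) @ \oo --> similitude_ratio (f j)}.

Lemma uniform_cvg_ball (U : choiceType) (V : pseudoMetricType R)
    (g_ : nat -> U -> V) (g : U -> V) (e : R) :
  {uniform, g_ @ \oo --> g} -> 0 < e ->
  \forall n \near \oo, forall x, ball (g x) e (g_ n x).
Proof.
move=> gg e0; apply: (gg [set h | forall x, ball (g x) e (h x)]).
apply/uniform_nbhs; exists [set xy | ball xy.1 e xy.2]; split.
  exact: entourage_ball (PosNum e0).
by move=> h /= gh x; exact: gh.
Qed.

(** The bound reproduces itself when a letter is added, since [c * d + d * (1 - c) = d]. Here [c]
    contracts the limit system, so the estimate is uniform in the word. *)
Lemma word_map_uniform_cvg (d : R) : 0 < d ->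
  \forall n \near \oo, forall w x,
    mdist (word_map f w x) (word_map (f_ n) w x) <= d.
Proof.
move=> d0; have [c /andP[c0 c1] fc] := similitude_ifs_contraction f ifs_f.
have d1 : 0 < d * (1 - c) by rewrite mulr_gt0// subr_gt0.
have : \forall n \near \oo, forall j x,
    mdist (f j x) (f_ n j x) < d * (1 - c).
  apply: filter_forall => j; have := uniform_cvg_ball _ _ _ _ _ (cvg_f j) d1.
  by apply: filterS => n fx x; have := fx x; rewrite ballEmdist.
apply: filterS => n fn w x; elim: w => [|j w ih] /=;
  first by rewrite mdistxx ltW.
rewrite (le_trans (metric_triangle _ (f j (word_map (f_ n) w x)) _))//.
have h1 := fc j (word_map f w x) (word_map (f_ n) w x).
have h2 := fn j (word_map (f_ n) w x).
have h3 : c * mdist (word_map f w x) (word_map (f_ n) w x) <= c * d.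
  by rewrite ler_wpM2l// ltW.
by move: h1 h2 h3; lra.
Qed.

Lemma similitude_ratio_unif_continuous (e : R) : 0 < e ->
  exists2 d : R, 0 < d & forall j x y, mdist x y <= d ->
    `|similitude_ratio (f j) x - similitude_ratio (f j) y| <= e.
Proof.
move=> e0.
have /choice[d dP] : forall j, exists d : R, 0 < d /\ forall x y, mdist x y <=
  d ->
    `|similitude_ratio (f j) x - similitude_ratio (f j) y| <= e.
  move=> j; have [_ _ _ [C [a [/andP[a0 _] Ca]]]] := ifs_f j.
  have C0 : 0 < `|C| + 1 by rewrite ltr_wpDl.
  have eC : 0 < e / (`|C| + 1) by rewrite divr_gt0.
  exists ((e / (`|C| + 1)) `^ a^-1); split => [|x y xy]; first exact: powR_gt0.
  apply: (le_trans (Ca x y)).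
  apply: (@le_trans _ _ ((`|C| + 1) * mdist x y `^ a)).
    by rewrite ler_wpM2r ?powR_ge0// (le_trans (ler_norm _))// lerDl.
  rewrite mulrC -ler_pdivlMr//.
  have := ler_powRl _ a _ _ (ltW a0) (mdist_ge0 x y) xy.
  by rewrite -powRrM mulVf ?gt_eqF// powRr1// ltW.
have [j|d' /andP[d'0 _] d'P] := @finite_lower_bound R _ d;
  first by case: (dP j).
exists d' => // j x y xy; have [_] := dP j; apply.
exact: le_trans (d'P j).
Qed.

Lemma ifs_weight_perturb (l : R) : 1 < l -> \forall n \near \oo, forall w,
  ifs_weight r (f_ n) (p_ n) w <= l ^+ size w * ifs_weight r f p w /\
  ifs_weight r f p w <= l ^+ size w * ifs_weight r (f_ n) (p_ n) w.
Proof.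
move=> l1; have l0 : 0 < l by lra.
have powl (x : R) : 0 < x -> 1 < l `^ x.
  by move=> x0; have := @gt0_ltr_powR R x x0 1 l; rewrite powR1; apply;
    rewrite // nnegrE ltW.
pose l2 := l `^ 2^-1.
have l21 : 1 < l2 by exact: powl.
pose l3 := l `^ (2 * r)^-1.
have l31 : 1 < l3 by apply: powl; rewrite invr_gt0 mulr_gt0.
have lE : l = l2 * l3 `^ r.
  rewrite /l2 /l3 -powRrM -powRD; last by rewrite (gt_eqF l0) implybT.
  rewrite (_ : _ + _ = 1) ?powRr1 ?(ltW l0)//.
  by field; rewrite gt_eqF.
have [a a0 aP] := similitude_ratio_lower_bound f perfectX ifs_f bd_f.
pose e := a * (l3 - 1) / l3.
have e0 : 0 < e by rewrite /e divr_gt0 ?mulr_gt0 ?subr_gt0//; lra.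
have e20 : 0 < e / 2 by rewrite divr_gt0.
have [d d0 dP] := similitude_ratio_unif_continuous _ e20.
(* For numbers bounded away from 0, a small additive error is a multiplicative factor close to 1. *)
have close (b l' x y : R) : 0 < b -> 1 < l' -> b <= x ->
    `|x - y| <= b * (l' - 1) / l' -> y <= l' * x /\ x <= l' * y.
  move=> b0 l'1 bx; have l'0 : 0 < l' by lra.
  rewrite ler_pdivlMr// => xy.
  have bx' : b * (l' - 1) <= x * (l' - 1) by rewrite ler_wpM2r// subr_ge0 ltW.
  have xy1 : `|x - y| <= `|x - y| * l' by rewrite ler_peMr// ltW.
  have xy2 : (x - y) * l' <= `|x - y| * l' by rewrite ler_wpM2r ?ler_norm// ltW.
  have := ler_norm (y - x); rewrite distrC => xy3.
  by split; lra.
have near_p : \forall n \near \oo, forall j,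
    p_ n j <= l2 * p j /\ p j <= l2 * p_ n j.
  apply: filter_forall => j; have pj0 := prob_p.1 j.
  have pe : 0 < p j * (l2 - 1) / l2.
    by rewrite divr_gt0 ?mulr_gt0 ?subr_gt0//; lra.
  have := cvg_p j; move=> /cvgrPdist_le /(_ _ pe); apply: filterS => n.
  exact: close.
have near_D : \forall n \near \oo, forall j x,
    `|similitude_ratio (f j) x - similitude_ratio (f_ n j) x| < e / 2.
  apply: filter_forall => j; exact: uniform_cvg_ball _ _ _ _ _ (cvg_Df j) e20.
have near_w := word_map_uniform_cvg d d0.
near=> n.
have pn : forall j, p_ n j <= l2 * p j /\ p j <= l2 * p_ n j by near: n.
have Dn : forall j x,
  `|similitude_ratio (f j) x - similitude_ratio (f_ n j) x| < e / 2.
  by near: n.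
have wn : forall w x, mdist (word_map f w x) (word_map (f_ n) w x) <= d.
  by near: n.
have weightE g q j v : similitude_ifs g -> ifs_weight r g q (j :: v) =
    (q j * similitude_ratio (g j) (word_map g v point) `^ r) * ifs_weight r g q v.
  move=> ifs_g; have g_gt0 : 0 < similitude_ratio (g j) (word_map g v point).
    by have [_ _ + _] := ifs_g j; exact.
  rewrite /ifs_weight /word_weight big_cons/= powRM ?(ltW g_gt0)//;
    first by ring.
  by rewrite ltW// word_ratio_gt0.
elim=> [|j v [ih1 ih2]].
  by rewrite /ifs_weight /word_weight !big_nil /= expr0 !mul1r.
rewrite !weightE//.
have D_gt0 : 0 < similitude_ratio (f j) (word_map f v point).
  by have [_ _ + _] := ifs_f j; exact.
have Dn_gt0 : 0 < similitude_ratio (f_ n j) (word_map (f_ n) v point).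
  by have [_ _ + _] := ifs_f_ n j; exact.
have weight_ge0 g q u : (forall j, 0 < q j) -> 0 <= ifs_weight r g q u.
  by move=> q0; rewrite mulr_ge0 ?powR_ge0// ltW// word_weight_gt0.
have [D1 D2] : similitude_ratio (f_ n j) (word_map (f_ n) v point) <=
    l3 * similitude_ratio (f j) (word_map f v point) /\
    similitude_ratio (f j) (word_map f v point) <=
    l3 * similitude_ratio (f_ n j) (word_map (f_ n) v point).
  apply: (close a) => //; rewrite -/e.
  (* One half of [e] pays for moving between the orbits, the other for replacing the derivative. *)
  have h1 := dP j _ _ (wn v point).
  have h2 := Dn j (word_map (f_ n) v point).
  apply: le_trans (ler_distD (similitude_ratio (f j) (word_map (f_ n) v point)) _ _) _.
  by lra.
have letter (p1 p2 D1' D2' q1 q2 : R) : 0 < p1 -> 0 < D1' -> 0 < p2 ->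
  0 < D2' ->
    0 <= q1 -> p1 <= l2 * p2 -> D1' <= l3 * D2' -> q1 <= l ^+ size v * q2 ->
    p1 * D1' `^ r * q1 <= l ^+ (size v).+1 * (p2 * D2' `^ r * q2).
  move=> p10 D10 p20 D20 q10 pp DD qq.
  have -> : l ^+ (size v).+1 * (p2 * D2' `^ r * q2) =
      (l2 * p2) * (l3 `^ r * D2' `^ r) * (l ^+ size v * q2).
    by rewrite exprS {1}lE; ring.
  apply: ler_pM => //; first by rewrite mulr_ge0 ?powR_ge0// ltW.
  apply: ler_pM => //; rewrite ?powR_ge0 ?(ltW p10)//.
  rewrite -powRM ?(ltW D20) ?(le_trans ler01 (ltW l31))//.
  by apply: ler_powRl => //; exact: ltW.
have p0 := prob_p.1; have p_0 := (prob_p_ n).1.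
by have [pn1 pn2] := pn j; split; apply: letter => //; exact: weight_ge0.
Unshelve. all: by end_near. Qed.

Lemma critical_exponent_cvg (t0 : R) (t_ : nat -> R) (g : R) (g_ : nat -> R) :
  0 < g < 1 -> (forall n, 0 < g_ n < 1) ->
  (forall w, 0 < ifs_weight r f p w <= g ^+ size w) ->
  (forall n w, 0 < ifs_weight r (f_ n) (p_ n) w <= g_ n ^+ size w) ->
  0 <= t0 < 1 -> subcritical (ifs_weight r f p) t0 ->
  (forall n, 0 <= t_ n < 1) ->
  (forall n, subcritical (ifs_weight r (f_ n) (p_ n)) (t_ n)) ->
  (fun n => critical_exponent (ifs_weight r (f_ n) (p_ n))) @ \oo -->
    critical_exponent (ifs_weight r f p).
Proof.
move=> g01 g_01 qg q_g t01 sub t_1 sub_; apply/cvgrPdist_le => e e0.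
have /andP[g0 g1] := g01.
pose d := Num.min e 1.
have d01 : 0 < d <= 1 by rewrite lt_min e0 ltr01 ge_min lexx orbT.
have de : d <= e by rewrite ge_min lexx.
have /andP[d0 d1] := d01; have d01' : 0 <= d <= 1 by rewrite ltW.
(* The rates [g_ n] may depend on [n]; the larger rate [h] will serve the limit and all close
   systems at once. *)
pose h := g `^ 2^-1; have h0 : 0 < h by rewrite powR_gt0.
have hh : h * h = g.
  rewrite /h -powRD; last by rewrite (gt_eqF g0) implybT.
  by rewrite (_ : _ + _ = 1) ?powRr1 ?(ltW g0)//; field.
have h1 : h < 1 by rewrite ltNge; apply/negP => h1; move: g1; nra.
have h01 : 0 < h < 1 by rewrite h0.
have gh : g <= h by rewrite -hh ler_piMr ?(ltW h0)// ltW.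
pose l := h `^ (- (d / 2)); have l0 : 0 < l by rewrite powR_gt0.
have hd1 x : 0 < x -> h `^ x < 1.
  by move=> x0; have := @gt0_ltr_powR R x x0 h 1; rewrite powR1; apply;
    rewrite ?nnegrE ?ltW.
have l1 : 1 < l.
  by rewrite /l powRN invf_gt1 ?powR_gt0// hd1// divr_gt0.
have llh : l ^+ 2 * h `^ d <= 1.
  rewrite /l powRN exprVn -powR_mulrn ?powR_ge0// -powRrM divfK ?pnatr_eq0//.
  by rewrite mulVf// gt_eqF// powR_gt0.
have lgh : l * g <= h.
  rewrite -hh mulrA ler_piMl ?(ltW h0)// /l powRN ler_pdivrMl ?powR_gt0// mulr1.
  have := @ger_powR R h; rewrite h0 (ltW h1) => /(_ isT (d / 2) 1).
  by rewrite powRr1 ?(ltW h0)//; apply; lra.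
have := ifs_weight_perturb l l1; apply: filterS => n ln.
have q0 w : 0 < ifs_weight r f p w by have /andP[] := qg w.
have q_0 w : 0 < ifs_weight r (f_ n) (p_ n) w by have /andP[] := q_g n w.
have qh w : 0 < ifs_weight r f p w <= h ^+ size w.
  rewrite q0; have /andP[_ /le_trans] := qg w; apply.
  by rewrite lerXn2r// nnegrE ltW.
have q_h w : 0 < ifs_weight r (f_ n) (p_ n) w <= h ^+ size w.
  rewrite q_0 (le_trans (ln w).1)//.
  apply: (@le_trans _ _ ((l * g) ^+ size w)).
    by rewrite exprMn ler_wpM2l ?exprn_ge0 ?(ltW l0)//; have /andP[] := qg w.
  by rewrite lerXn2r ?nnegrE ?mulr_ge0 ?(ltW l0) ?(ltW g0) ?(ltW h0).
have h2 : critical_exponent (ifs_weight r (f_ n) (p_ n)) <=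
    critical_exponent (ifs_weight r f p) + d.
  apply: (critical_exponent_perturb _ _ t0 l h d h01 (ltW l1) d01' llh qh _ t01 sub).
  by move=> w; rewrite q_0; exact: (ln w).1.
have h3 : critical_exponent (ifs_weight r f p) <=
    critical_exponent (ifs_weight r (f_ n) (p_ n)) + d.
  apply: (critical_exponent_perturb _ _ (t_ n) l h d h01 (ltW l1) d01' llh q_h _
    (t_1 n) (sub_ n)).
  by move=> w; rewrite q0; exact: (ln w).2.
rewrite ler_distl lerBlDr; apply/andP; split.
  by apply: le_trans h2 _; rewrite lerD2l.
by apply: le_trans h3 _; rewrite lerD2l.
Qed.

End perturbation.

Theorem proposition3p24 (R : realType) (X : pointedMetricType R)
  (compactX : compact [set: X]) (perfectX : perfect_set [set: X]) (N : nat)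
  (f_ : nat -> 'I_N -> X -> X) (p_ : nat -> 'I_N -> R)
  (f : 'I_N -> X -> X) (p : 'I_N -> R)
  (prob_p_ : forall n, probability_vector (p_ n))
  (prob_p : probability_vector p)
  (ifs_f_ : forall n, similitude_ifs (f_ n)) (ifs_f : similitude_ifs f)
  (bd_f_ : forall n, bounded_distortion (f_ n)) (bd_f : bounded_distortion f)
  (sosc_f_ : forall n, strong_open_set_condition (f_ n))
  (sosc_f : strong_open_set_condition f)
  (mu_ : nat -> probability (borel X) R) (mu : probability (borel X) R)
  (inv_mu_ : forall n, invariant_measure (f_ n) (p_ n) (mu_ n))
  (inv_mu : invariant_measure f p mu)
  (cvg_f : forall j, {uniform, (fun n => f_ n j) @ \oo --> f j})
  (cvg_p : forall j, (fun n => p_ n j) @ \oo --> p j)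
  (cvg_Df : forall j, {uniform,
    (fun n => similitude_ratio (f_ n j)) @ \oo --> similitude_ratio (f j)})
  (r : R) (r_gt0 : 0 < r) :
  exists (D_ : nat -> R) (D : R),
    [/\ forall n, is_quantization_dimension r (mu_ n) (D_ n),
        is_quantization_dimension r mu D
      & D_ @ \oo --> D].
Proof.
have H_ n := ifs_quantization_dimension R X N (f_ n) (p_ n) (mu_ n) r compactX
  perfectX (prob_p_ n) (ifs_f_ n) (bd_f_ n) (sosc_f_ n) (inv_mu_ n) r_gt0.
have [[g g01 qg] [t0 t01 sub] dim] := ifs_quantization_dimension R X N f p mu r
  compactX perfectX prob_p ifs_f bd_f sosc_f inv_mu r_gt0.
have /choice[g_ gP] : forall n, exists g' : R, 0 < g' < 1 /\
    forall w, 0 < ifs_weight r (f_ n) (p_ n) w <= g' ^+ size w.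
  by move=> n; have [[g' ? ?] _ _] := H_ n; exists g'.
have /choice[t_ tP] : forall n, exists t : R, 0 <= t < 1 /\
    subcritical (ifs_weight r (f_ n) (p_ n)) t.
  by move=> n; have [_ [t ? ?] _] := H_ n; exists t.
pose th_ n := critical_exponent (ifs_weight r (f_ n) (p_ n)).
pose th := critical_exponent (ifs_weight r f p).
exists (fun n => r * th_ n / (1 - th_ n)), (r * th / (1 - th)); split.
- by move=> n; have [_ _ dim_n] := H_ n; exact: dim_n.
- exact: dim.
have th_th : th_ @ \oo --> th.
  exact: (critical_exponent_cvg f_ p_ f p r perfectX r_gt0 prob_p_ prob_p ifs_f_
    ifs_f bd_f cvg_f cvg_p cvg_Df t0 t_ g g_ g01 (fun n => (gP n).1) qg
    (fun n => (gP n).2) t01 sub (fun n => (tP n).1) (fun n => (tP n).2)).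
(* Strict inequality keeps [1 - th] away from 0, so the formula for the dimension is continuous at
   [th]. *)
have th1 : th < 1.
  have /andP[t00 t1] := t01.
  by apply: le_lt_trans t1; exact: critical_exponent_le t00 sub.
move: th_ th th_th th1 => th_ th th_th th1.
apply: cvgM; first by apply: cvgM; [exact: cvg_cst|exact: th_th].
apply: cvgV; first by rewrite subr_eq0 gt_eqF.
by apply: cvgB; [exact: cvg_cst|exact: th_th].
Qed.
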